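(* Let $\Sigma_{\mathbf{A}}\subseteq\Sigma=\mathcal{A}^{\mathbb{N}}$ be an aperiodic and irreducible subshift of finite type. For every sequence $(\phi_i)_{i\ge 0}$ of uniformly equicontinuous potentials $\phi_i\colon\Sigma_{\mathbf{A}}\to\mathbb{R}$, the function $\alpha\mapsto h_{\rm top}(L_{\mathbf{A}}(\alpha))$ is continuous and concave over its domain $\{\alpha\in\mathbb{R}: L_{\mathbf{A}}(\alpha)\neq\emptyset\}$, and this domain is a (possibly empty) closed interval.
   Context: $\mathbb{N}=\{0,1,2,\dots\}$, $\mathcal{A}=\{1,\dots,K\}$ is a finite alphabet, $\Sigma=\mathcal{A}^{\mathbb{N}}$, and $\sigma$ is the left shift. For a finite word $\mathbf{i}$, $[\mathbf{i}]$ is the cylinder of sequences starting with $\mathbf{i}$, whose level $l([\mathbf{i}])$ is the length of $\mathbf{i}$. For a $K\times K$ matrix $\mathbf{A}$ with entries in $\{0,1\}$, the subshift of finite type is $\Sigma_{\mathbf{A}}=\{\mathbf{i}=(i_0,i_1,\dots)\in\Sigma:\mathbf{A}_{i_k,i_{k+1}}=1\ \forall k\ge 0\}$; every symbol of $\mathcal{A}$ is assumed to occur in some element of $\Sigma_{\mathbf{A}}$. It is aperiodic and irreducible if there is $r\ge1$ such that all entries of $\mathbf{A}^r$ are strictly positive. Potentials are continuous functions. The sequence $(\phi_i)$ is uniformly equicontinuous if $\rho^{(1)}_n:=\sup_i \mathrm{var}_n(\phi_i)$ is finite for every $n\in\mathbb{N}$ and $\rho^{(1)}_n\to0$ as $n\to\infty$,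 where $\mathrm{var}_n(\phi)$ is the supremum of $|\phi(\mathbf{j})-\phi(\mathbf{k})|$ over all $\mathbf{j},\mathbf{k}\in\Sigma_{\mathbf{A}}$ lying in a common cylinder of level $n$ (for $n=0$: over all $\mathbf{j},\mathbf{k}\in\Sigma_{\mathbf{A}}$). $L_{\mathbf{A}}(\alpha)=\{\mathbf{i}\in\Sigma_{\mathbf{A}}:\lim_{n\to\infty}\frac1n\sum_{i=0}^{n-1}\phi_i(\sigma^i\mathbf{i})=\alpha\}$. Topological entropy of $E\subseteq\Sigma$: let $\mathcal{H}^s_r(E)=\inf\sum_{C}e^{-s\,l(C)}$, the infimum over all covers of $E$ by cylinders of level larger than $r$; $\mathcal{H}^s(E)=\lim_{r\to\infty}\mathcal{H}^s_r(E)$; $h_{\rm top}(E)=\inf\{s\ge0:\mathcal{H}^s(E)<\infty\}$ for $E\ne\emptyset$, and $h_{\rm top}(\emptyset)=-\infty$. *)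

(* Defs.v *)
From HB Require Import structures.
From mathcomp Require Import all_boot all_order all_algebra.
From mathcomp Require Import all_classical all_reals all_analysis.

Set Implicit Arguments.
Unset Strict Implicit.
Unset Printing Implicit Defensive.

Import Order.TTheory GRing.Theory Num.Theory.
Import numFieldNormedType.Exports.

Local Open Scope classical_set_scope.
Local Open Scope ring_scope.

(* Sequences over the alphabet 'I_K (symbols are numbered from 0), with the
   product of the discrete topologies. *)
Notation fullshift K :=
  (prod_topology (fun _ : nat => discrete_topology 'I_K)).

Section SymbolicDynamics.
Variable K : nat.
Implicit Types (x y : fullshift K) (A : 'M[nat]_K) (w : seq 'I_K).

Definition shift x : fullshift K := fun k => x k.+1.

Definition cylinder w : set (fullshift K) :=
  [set x | mkseq (x : nat -> 'I_K) (size w) = w].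

Definition zero_one_mx A : Prop := forall i j, (A i j <= 1)%N.

Definition sft A : set (fullshift K) :=
  [set x | forall k, A (x k) (x k.+1) = 1%N].

Definition all_symbols_occur A : Prop :=
  forall a : 'I_K, exists2 x, sft A x & exists k, x k = a.

(* The power is taken in the matrices over the semiring nat. *)
Definition aperiodic_irreducible A : Prop :=
  exists r : nat, (1 <= r)%N /\ forall i j, (0 < (A ^+ r) i j)%N.

Section Potentials.
Variables (R : realType) (A : 'M[nat]_K).
Implicit Types (phi : nat -> fullshift K -> R) (f : fullshift K -> R).

Definition variation f (n : nat) : \bar R :=
  ereal_sup [set e : \bar R | exists w x y,
    [/\ size w = n, (sft A `&` cylinder w) x, (sft A `&` cylinder w) y
      & e = `|f x - f y|%:E]].

Definition rho1 phi (n : nat) : \bar R :=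
  ereal_sup (range (fun i : nat => variation (phi i) n)).

Definition uniformly_equicontinuous phi : Prop :=
  (forall n, rho1 phi n \is a fin_num) /\ rho1 phi @ \oo --> 0%E.

Definition birkhoff_average phi x (n : nat) : R :=
  n%:R^-1 * \sum_(i < n) phi i (iter i shift x).

Definition level_set phi (alpha : R) : set (fullshift K) :=
  [set x | sft A x /\ birkhoff_average phi x @ \oo --> alpha].

End Potentials.

Section TopologicalEntropy.
Variable R : realType.
Implicit Types (E : set (fullshift K)) (s : R).

(* Covers are indexed by words rather than by the cylinders they define: the
   level is a function of the word (if K = 1 all cylinders coincide). *)
Definition cylinder_cover E (r : nat) (W : set (seq 'I_K)) : Prop :=
  (forall w, W w -> (r < size w)%N) /\ E `<=` \bigcup_(w in W) cylinder w.

Definition cylinder_premeasure s (r : nat) E : \bar R :=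
  ereal_inf [set (\esum_(w in W) (expR (- s * (size w)%:R))%:E)%E
            | W in cylinder_cover E r].

Definition cylinder_measure s E : \bar R :=
  limn (fun r => cylinder_premeasure s r E).

Definition htop E : \bar R :=
  if E == set0 then -oo%E
  else ereal_inf [set s%:E | s in [set s : R |
                   0 <= s /\ (cylinder_measure s E < +oo)%E]].

End TopologicalEntropy.

End SymbolicDynamics.

Definition concave_on (R : realType) (D : set R) (h : R -> \bar R) : Prop :=
  forall a b t : R, D a -> D b -> 0 <= t <= 1 ->
    (t%:E * h a + (1 - t)%:E * h b <= h (t * a + (1 - t) * b)%R)%E.

(* Main.v *)
Require Import Defs.
From HB Require Import structures.
From mathcomp Require Import all_boot all_order all_algebra.
From mathcomp Require Import all_classical all_reals all_analysis.
From mathcomp Require Import zify ring lra.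
Import Order.TTheory GRing.Theory Num.Theory.
Import numFieldNormedType.Exports.
Local Open Scope classical_set_scope.
Local Open Scope ring_scope.

(* Cut time into consecutive blocks of slowly growing length.  In the k-th block
   the first q symbols are sacrificed to connect to the previous block, so that
   admissible words for the different blocks can be concatenated freely, and by
   equicontinuity the Birkhoff sum over a block depends, up to a negligible
   error, only on its word.  Say that (b, s) is good if there is a sequence of
   block words whose values average to b and such that the number of words with
   nearly the same values, multiplied over the blocks, grows at least like
   exp (s n).

   If s < htop (L b), some single x in L b is a witness that (b, s) is good:
   otherwise the prefixes of points of L b that violate the growth condition
   cover L b, and since there are only subexponentially many value profiles
   this cover is too cheap.  Conversely, if (b, s) is good, gluing words with
   nearly the same values gives points of L b, and in a cheap cover one can
   successively choose words of least remaining cost to reach an uncovered point,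
   so htop (L b) >= s.  Good pairs form a convex set (alternate between two
   sequences block by block, keeping both error sums small) which is closed up
   to a loss in s (switch between sequences along a fast growing sequence of
   times).  Hence the hypograph of the entropy is convex and closed, which gives
   everything since the entropy is bounded. *)

Set Implicit Arguments.
Unset Strict Implicit.
Unset Printing Implicit Defensive.

(** * Blocks of increasing length *)

Section Stairs.
Variable f : nat -> nat.
Hypothesis f_mono : {mono f : m n / (m < n)%N}.

Lemma stair_mono : {mono f : m n / (m <= n)%N}.
Proof. by move=> m n; rewrite leqNgt f_mono -leqNgt. Qed.

Lemma leq_stair n : (n <= f n)%N.
Proof. by elim: n => // n IH; rewrite (leq_ltn_trans IH)// f_mono. Qed.

Lemma stair_subproof (j : nat) : exists k, (j < f k.+1)%N.
Proof. by exists j; apply: leq_stair. Qed.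

(** Used both for the block containing a position and for the regime in force at a given time. Below
    [f 0] the value is 0. *)
Definition stair j := ex_minn (stair_subproof j).

Lemma stairE k j : (f k <= j < f k.+1)%N -> stair j = k.
Proof.
move=> /andP[kj jk]; rewrite /stair; case: ex_minnP => b jb bmin.
apply/eqP; rewrite eqn_leq bmin //= leqNgt; apply/negP => bk.
by have := leq_trans jb (leq_trans _ kj); rewrite ltnn stair_mono => /(_ bk).
Qed.

Lemma stairP j : (f 0 <= j)%N -> (f (stair j) <= j < f (stair j).+1)%N.
Proof.
rewrite /stair; case: ex_minnP => -[|b] jb bmin j0; rewrite jb ?andbT//.
by rewrite leqNgt; apply/negP => /bmin; rewrite ltnn.
Qed.

End Stairs.

Section Blocks.
Variable q : nat.

(* In block [k], [q] connecting symbols are followed by a word of length [k.+1]. *)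
Definition blen (k : nat) : nat := (q + k.+1)%N.
Definition bstart (n : nat) : nat := (\sum_(k < n) blen k)%N.

Lemma bstart0 : bstart 0 = 0%N. Proof. by rewrite /bstart big_ord0. Qed.

Lemma bstartS n : bstart n.+1 = (bstart n + blen n)%N.
Proof. by rewrite /bstart big_ord_recr. Qed.

Lemma leq_bstart n : (n <= bstart n)%N.
Proof. by elim: n => // n IH; rewrite bstartS /blen; lia. Qed.

Lemma ltn_bstart : {mono bstart : m n / (m < n)%N}.
Proof.
apply: leqW_mono; apply: leq_mono => m n; elim: n => // n IH.
rewrite ltnS leq_eqVlt bstartS /blen => /orP[/eqP->|/IH]; lia.
Qed.

(** Quadratic growth makes the number of blocks, and the length of a single block, negligible
    against the elapsed time. *)
Lemma sqr_leq_bstart n : (n * n <= 2 * bstart n)%N.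
Proof. by elim: n => // n IH; rewrite bstartS /blen; nia. Qed.

Definition block_index := stair ltn_bstart.

Lemma block_indexE k j : (bstart k <= j < bstart k.+1)%N -> block_index j = k.
Proof. exact: stairE. Qed.

Lemma block_indexP j :
  (bstart (block_index j) <= j < bstart (block_index j).+1)%N.
Proof. by apply: stairP; rewrite bstart0. Qed.

End Blocks.

Section Vanishing.
Variables (R : realType) (q : nat).
Implicit Types X Y : nat -> R.
Local Notation c := (bstart q).

(* [X n] is [o(bstart q n)]. *)
Definition vanishing X := forall e : R, 0 < e ->
  exists N, forall n, (N <= n)%N -> `|X n| <= e * (c n)%:R.

Lemma vanishing_le X Y :
  (forall n, `|X n| <= Y n) -> vanishing Y -> vanishing X.
Proof.
move=> XY nY e /nY[N HN]; exists N => n /HN.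
by apply: le_trans; apply: le_trans (XY n) (ler_norm _).
Qed.

Lemma vanishing_eq X Y : X =1 Y -> vanishing X -> vanishing Y.
Proof. by move=> /funext->. Qed.

Lemma vanishingD X Y :
  vanishing X -> vanishing Y -> vanishing (fun n => X n + Y n).
Proof.
move=> nX nY e e0; have e20 : 0 < e / 2 by lra.
have [N1 H1] := nX _ e20; have [N2 H2] := nY _ e20.
exists (maxn N1 N2) => n; rewrite geq_max => /andP[/H1 ? /H2 ?].
apply: le_trans (ler_normD _ _) _; lra.
Qed.

Lemma vanishingZ a X : vanishing X -> vanishing (fun n => a * X n).
Proof.
move=> nX e e0; have a1 : 0 < `|a| + 1 by have := normr_ge0 a; lra.
have [|N H] := nX (e / (`|a| + 1)); first exact: divr_gt0.
exists N => n /H Hn; rewrite normrM.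
apply: (@le_trans _ _ ((`|a| + 1) * (e / (`|a| + 1) * (c n)%:R))).
  by apply: ler_pM => //; lra.
by rewrite mulrA mulrCA mulfV ?mulr1// gt_eqF.
Qed.

Lemma vanishing_natr : vanishing (fun n => n%:R).
Proof.
move=> e e0; exists (Num.bound (2 / e)) => n Hn.
have /(lt_le_trans (archi_boundP _)) H : ((Num.bound (2 / e))%:R <= n%:R :> R).
  by rewrite ler_nat.
have {}H : 2 < e * n%:R by rewrite mulrC -ltr_pdivrMr// H// divr_ge0// ltW.
have := sqr_leq_bstart q n; rewrite -(@ler_nat R) !natrM => Hc.
rewrite ger0_norm//; have : 0 <= n%:R :> R by []. nra.
Qed.

Lemma vanishing_blen : vanishing (fun n => (blen q n)%:R).
Proof.
have H : vanishing (fun n => n%:R * (q.+2)%:R).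
  have := @vanishingZ q.+2%:R _ vanishing_natr.
  by under eq_fun do rewrite mulrC.
move=> e /H[N HN]; exists (maxn N 1) => n; rewrite geq_max => /andP[/HN Hn n1].
apply: le_trans Hn; rewrite -natrM !ger0_norm// ler_nat /blen; nia.
Qed.

Lemma vanishing_cst a : vanishing (fun => a).
Proof.
have := @vanishingZ a _ vanishing_natr => H.
move=> e /H[N HN]; exists (maxn N 1) => n; rewrite geq_max => /andP[/HN Hn n1].
apply: le_trans Hn; rewrite normrM ler_peMr// ger0_norm//.
by rewrite -[1]/(1%:R) ler_nat.
Qed.

End Vanishing.

(** * Combining sequences *)

Section Selection.
Variable R : realType.
Implicit Types (x y : nat -> R) (t : R).

(* The bit [k] is chosen so that the new step makes an obtuse angle with the
   accumulated error, whose square then grows by at most that of the step. *)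
Fixpoint selection_error x y t (n : nat) : R * R :=
  if n is k.+1 then
    let e := selection_error x y t k in
    let b := (e.1 * x k + e.2 * y k <= 0)%R in
    (e.1 + (b%:R - t) * x k, e.2 + (b%:R - t) * y k)
  else (0, 0).

Lemma selection_sqr x y t : 0 <= t <= 1 -> exists b : nat -> bool, forall n,
  (\sum_(k < n) ((b k)%:R - t) * x k) ^+ 2 +
  (\sum_(k < n) ((b k)%:R - t) * y k) ^+ 2 <= \sum_(k < n) (x k ^+ 2 + y k ^+ 2).
Proof.
move=> /andP[t0 t1]; pose e := selection_error x y t.
pose b k := (e k).1 * x k + (e k).2 * y k <= 0; exists b => n.
have E m : (\sum_(k < m) ((b k)%:R - t) * x k = (e m).1) *
           (\sum_(k < m) ((b k)%:R - t) * y k = (e m).2).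
  elim: m => [|m [IH1 IH2]]; first by rewrite !big_ord0.
  by split; rewrite big_ord_recr /= ?IH1 ?IH2.
rewrite !E; elim: n => [|n IH]; first by rewrite big_ord0 /= expr0n addr0.
rewrite big_ord_recr /= -/e -/(b n).
(* This is half the cross term in the expansion of the new squared error. *)
have H : ((b n)%:R - t) * ((e n).1 * x n + (e n).2 * y n) <= 0.
  rewrite /b; case: (lerP (_ + _) 0) => /= X0.
    by rewrite mulr_ge0_le0// subr_ge0.
  by rewrite sub0r mulr_le0_ge0 ?oppr_le0// ltW.
have Hb : ((b n)%:R - t) ^+ 2 <= 1 by case: (b n) => /=; nra.
have : ((b n)%:R - t) ^+ 2 * (x n ^+ 2 + y n ^+ 2) <= x n ^+ 2 + y n ^+ 2.
  by rewrite ler_piMl// addr_ge0// sqr_ge0.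
move: IH H; set S := \sum_(_ < _) _; move: ((b n)%:R - t) => z; nra.
Qed.

(** Since [blen] is negligible against [bstart], the bound on the square is negligible against the
    square of [bstart]. *)
Lemma sqr_vanishing q (X : nat -> R) (C : R) :
  (forall n, X n ^+ 2 <= C * (blen q n * bstart q n)%:R) -> vanishing q X.
Proof.
move=> XC e e0.
have e20 : 0 < e ^+ 2 by rewrite exprn_gt0.
have [N HN] := vanishingZ C (@vanishing_blen R q) e20.
exists N => n /HN Hn; have c0 : 0 <= (bstart q n)%:R :> R by [].
rewrite -ler_sqr ?nnegrE// ?mulr_ge0 ?(ltW e0)// real_normK ?num_real//.
apply: le_trans (XC n) _; rewrite natrM mulrA.
have -> : (e * (bstart q n)%:R) ^+ 2 = e ^+ 2 * (bstart q n)%:R * (bstart q n)%:R.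
  by ring.
by rewrite ler_wpM2r// (le_trans (ler_norm _)).
Qed.

(** Meant for [x] and [y] the differences of two sequences in value and in [lam]: taking the first
    sequence exactly where the bit is set mixes both quantities in proportion [t] at once. *)
Lemma selection q x y t (C : R) : 0 <= t <= 1 ->
  (forall k, `|x k| <= C * (blen q k)%:R) ->
  (forall k, `|y k| <= C * (blen q k)%:R) ->
  exists b : nat -> bool,
    vanishing q (fun n => \sum_(k < n) ((b k)%:R - t) * x k) /\
    vanishing q (fun n => \sum_(k < n) ((b k)%:R - t) * y k).
Proof.
move=> t01 xC yC; have [b Hb] := selection_sqr x y t01; exists b.
have H n : \sum_(k < n) (x k ^+ 2 + y k ^+ 2) <=
    2 * C ^+ 2 * (blen q n * bstart q n)%:R.
  rewrite /bstart natrM natr_sum !mulr_sumr; apply: ler_sum => k _.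
  have kn : (blen q k)%:R <= (blen q n)%:R :> R.
    by rewrite ler_nat /blen leq_add2l ltnS ltnW.
  have H z : `|z| <= C * (blen q k)%:R ->
      z ^+ 2 <= C ^+ 2 * (blen q n)%:R * (blen q k)%:R.
    move=> zC; rewrite -real_normK ?num_real//.
    apply: (@le_trans _ _ ((C * (blen q k)%:R) ^+ 2)).
      by rewrite ler_sqr// nnegrE (le_trans (normr_ge0 z)).
    by rewrite exprMn -mulrA ler_wpM2l ?sqr_ge0// expr2 ler_wpM2r.
  have := H _ (xC k); have := H _ (yC k); lra.
by split; apply: (@sqr_vanishing _ _ (2 * C ^+ 2)) => n;
  apply: le_trans (H n); apply: le_trans (Hb n);
  rewrite ?lerDl ?lerDr sqr_ge0.
Qed.

End Selection.

(** * Switching between infinitely many sequences *)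

Section Diagonal.
Variable R : realType.

(** Past [T + N] nothing is below [f T], so a minimum over the finite window from [T] to [T + N] is
    a minimum over the whole tail. *)
Lemma argmin_tail (f : nat -> R) (T N : nat) :
  (forall n, (N <= n)%N -> f T <= f n) ->
  exists2 T', (T <= T')%N & forall n, (T <= n)%N -> f T' <= f n.
Proof.
move=> H.
suff [T' TT' HT'] : exists2 T', (T <= T')%N &
    forall n, (T <= n <= T + N)%N -> f T' <= f n.
  exists T' => // n Tn; have [nN|Nn] := leqP n (T + N).
    by apply: HT'; rewrite Tn.
  apply: (@le_trans _ _ (f T)); first by apply: HT'; lia.
  by apply: H; lia.
elim: {H} N => [|N [T' TT' HT']].
  by exists T => // n Hn; have -> : n = T by lia.
have [le|lt] := leP (f T') (f (T + N.+1)%N).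
  exists T' => // n Hn; have [->//|ne] := eqVneq n (T + N.+1)%N.
  by apply: HT'; lia.
exists (T + N.+1)%N => [|n Hn]; first by lia.
have [->//|ne] := eqVneq n (T + N.+1)%N.
by apply: (le_trans (ltW lt)); apply: HT'; lia.
Qed.

Lemma eq_tail_sum (a b : nat -> R) m n : (m <= n)%N ->
  (forall k, (m <= k < n)%N -> a k = b k) ->
  \sum_(k < n) a k - \sum_(k < m) a k = \sum_(k < n) b k - \sum_(k < m) b k.
Proof.
move=> mn; rewrite -(subnKC mn); elim: (n - m)%N {mn} => [|j IH] ab.
  by rewrite addn0 !subrr.
rewrite addnS !big_ord_recr /= ab ?addnS ?leq_addr ?leqnn// !(addrAC _ _ (- _)).
by rewrite IH// => k /andP[mk kj]; rewrite ab// mk addnS leqW.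
Qed.

Variable q : nat.
Local Notation c := (bstart q).

(** The excess of the sum of [l] over slope [s'] tends to infinity because [s' < s], so it attains
    its minimum over a tail; [T'] is such a minimiser. *)
Lemma exists_regime (w l : nat -> R) (e s s' : R) (T : nat) : 0 < e -> s' < s ->
  (exists N, forall n, (N <= n)%N -> `|\sum_(k < n) w k| <= e / 2 * (c n)%:R) ->
  (exists N, forall n, (N <= n)%N -> s * (c n)%:R <= \sum_(k < n) l k) ->
  exists2 T', (T <= T')%N & forall n, (T' <= n)%N ->
    `|\sum_(k < n) w k - \sum_(k < T') w k| <= e * (c n)%:R /\
    \sum_(k < T') l k - s' * (c T')%:R <= \sum_(k < n) l k - s' * (c n)%:R.
Proof.
move=> e0 ss' [N1 H1] [N2 H2]; pose f n := \sum_(k < n) l k - s' * (c n)%:R.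
pose T1 := maxn T N1.
have s0 : 0 < s - s' by lra.
have [N3 H3] := vanishing_cst q (f T1) s0.
have [n|T' TT' HT'] := @argmin_tail f T1 (maxn N2 N3).
  rewrite geq_max => /andP[/H2 ? /H3 /(le_trans (ler_norm _))?]; rewrite {2}/f; lra.
have := TT'; rewrite geq_max => /andP[? N1T']; exists T' => // n Tn; split.
  apply: (le_trans (ler_normB _ _)).
  have := H1 n (leq_trans N1T' Tn); have := H1 _ N1T'.
  have : (c T')%:R <= (c n)%:R :> R by rewrite ler_nat (stair_mono (@ltn_bstart q)).
  nra.
by apply: HT'; apply: leq_trans Tn.
Qed.

(* Sequence [p] is used between the times [T p] and [T p.+1].  Starting it where
   its excess over the slope [s'] is minimal makes that excess nondecreasing on
   the whole regime; the times grow fast enough to forget the past. *)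
Lemma diagonal_regimes (w l : nat -> nat -> R) (s s' : R) : s' < s ->
  (forall p, exists N, forall n, (N <= n)%N ->
     `|\sum_(k < n) w p k| <= 2^-1 ^+ p / 2 * (c n)%:R) ->
  (forall p, exists N, forall n, (N <= n)%N ->
     s * (c n)%:R <= \sum_(k < n) l p k) ->
  exists i : nat -> nat, vanishing q (fun n => \sum_(k < n) w (i k) k) /\
    exists N, forall n, (N <= n)%N -> s' * (c n)%:R <= \sum_(k < n) l (i k) k.
Proof.
(* Regimes are built for an intermediate slope; the gap [s2 - s'] finally absorbs the constant
   [L (T 0)]. *)
move=> ss' Hw Hl; pose s2 := (s + s') / 2.
have d0 p : 0 < 2^-1 ^+ p :> R by rewrite exprn_gt0// invr_gt0.
have : forall pT : nat * nat, exists T', (pT.2 <= T')%N /\ forall n, (T' <= n)%N ->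
    `|\sum_(k < n) w pT.1 k - \sum_(k < T') w pT.1 k| <= 2^-1 ^+ pT.1 * (c n)%:R /\
    \sum_(k < T') l pT.1 k - s2 * (c T')%:R <= \sum_(k < n) l pT.1 k - s2 * (c n)%:R.
  move=> [p T]; have s2s : s2 < s by rewrite /s2; lra.
  by have [T' ? ?] := exists_regime T (d0 p) s2s (Hw p) (Hl p); exists T'.
move=> /choice[g Hg].
(* The first summand makes [c (T p)] grow at least fourfold, the second makes [T] strictly
   increasing. *)
pose fix T (p : nat) : nat :=
  if p is p'.+1 then g (p, (4 * c (T p') + (T p').+1)%N) else g (0%N, 1%N).
have TS p : (4 * c (T p) + (T p).+1 <= T p.+1)%N.
  by case: (Hg (p.+1, (4 * c (T p) + (T p).+1)%N)).
have T0 : (1 <= T 0)%N by case: (Hg (0, 1)%N).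
have HT p n : (T p <= n)%N ->
    `|\sum_(k < n) w p k - \sum_(k < T p) w p k| <= 2^-1 ^+ p * (c n)%:R /\
    \sum_(k < T p) l p k - s2 * (c (T p))%:R <= \sum_(k < n) l p k - s2 * (c n)%:R.
  case: p => [|p] Tn; first by have [_] := Hg (0, 1)%N; apply.
  by have [_] := Hg (p.+1, (4 * c (T p) + (T p).+1)%N); apply.
have Tmono : {mono T : m n / (m < n)%N}.
  apply: leqW_mono; apply: leq_mono => m n; elim: n => // n IH.
  by rewrite ltnS leq_eqVlt => /orP[/eqP->|/IH]; have := TS n; lia.
pose i := stair Tmono; exists i.
pose W n := \sum_(k < n) w (i k) k; pose L n := \sum_(k < n) l (i k) k - s2 * (c n)%:R.
have reg p n : (T p <= n <= T p.+1)%N ->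
    `|W n| <= `|W (T p)| + 2^-1 ^+ p * (c n)%:R /\ L (T p) <= L n.
  move=> /andP[Tn nT]; have [Hn1 Hn2] := HT _ _ Tn.
  have E (a : nat -> nat -> R) : \sum_(k < n) a (i k) k - \sum_(k < T p) a (i k) k =
      \sum_(k < n) a p k - \sum_(k < T p) a p k.
    apply: (@eq_tail_sum (fun k => a (i k) k) (a p)) => // k /andP[Tk kn]; congr (a _ k).
    by apply: stairE; rewrite Tk (leq_trans kn).
  split; last by have := E l; rewrite /L; lra.
  have -> : W n = W (T p) + (W n - W (T p)) by lra.
  by apply: (le_trans (ler_normD _ _)); rewrite lerD2l E.
have cn m n : (m <= n)%N -> (c m)%:R <= (c n)%:R :> R.
  by move=> mn; rewrite ler_nat (stair_mono (@ltn_bstart q)).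
(* Relative to [C * 2^-1 ^+ p * c (T p.+1)], the error inherited at [T p.+1] is at most a quarter by
   the fourfold growth, and the new error at most a quarter since [4 <= C]. Together they give the
   half needed for [p.+1]. *)
pose C := 4 + `|W (T 0)|.
have C4 : 4 <= C by rewrite /C; have := normr_ge0 (W (T 0%N)); lra.
have HC p : `|W (T p)| <= C * 2^-1 ^+ p * (c (T p))%:R.
  elim: p => [|p IH].
    have : 1 <= (c (T 0))%:R :> R.
      by rewrite -[1]/(1%:R) ler_nat (leq_trans T0)// leq_bstart.
    by rewrite expr0 mulr1 /C; have := normr_ge0 (W (T 0%N)); nra.
  have [|HW _] := reg p (T p.+1); first by have := TS p; lia.
  have : 4 * (c (T p))%:R <= (c (T p.+1))%:R :> R.
    rewrite -natrM ler_nat (leq_trans _ (leq_bstart _ _))//.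
    by have := TS p; lia.
  rewrite exprS; have := d0 p; move: HW IH.
  set D := 2^-1 ^+ p; set b := (c (T p.+1))%:R; set a := (c (T p))%:R.
  move=> HW IH D0 ab.
  have b0 : 0 <= b by rewrite /b.
  have CD0 : 0 <= C * D by apply: mulr_ge0; lra.
  have := ler_wpM2l CD0 ab.
  have : 4 * (D * b) <= C * (D * b) by rewrite ler_wpM2r// mulr_ge0// ltW.
  lra.
have LT p : L (T 0%N) <= L (T p).
  elim: p => // p IH; have [|_] := reg p (T p.+1); first by have := TS p; lia.
  exact: le_trans.
split.
  move=> e e0; have [P HP] : exists P, (C + 1) * 2^-1 ^+ P <= e.
    exists (Num.bound ((C + 1) / e)).
    have := @archi_boundP _ ((C + 1) / e) _; rewrite divr_ge0 ?(ltW e0)//; last by lra.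
    move: (Num.bound _) => P /(_ isT); rewrite ltr_pdivrMr// => H.
    have : P%:R <= 2 ^+ P :> R by rewrite -natrX ler_nat ltnW// ltn_expl.
    rewrite exprVn ler_pdivrMr ?exprn_gt0// => ?; nra.
  exists (T P) => n Tn; have T0n : (T 0 <= n)%N.
    by apply: leq_trans Tn; rewrite (stair_mono Tmono).
  have /andP[Tin nTi] := stairP Tmono T0n.
  have [|HW _] := reg (i n) n; first by rewrite Tin ltnW.
  have Pi : (P <= i n)%N.
    by rewrite -ltnS -Tmono (leq_ltn_trans Tn).
  have DD : 2^-1 ^+ i n <= 2^-1 ^+ P :> R.
    by rewrite ler_wiXn2l// ?invr_ge0// invf_le1// ler1n.
  have := HC (i n); have := cn _ _ Tin; have := d0 (i n); move: DD HP HW.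
  change (\sum_(k < n) w (i k) k) with (W n).
  have : 0 <= (c (T (i n)))%:R :> R by [].
  move: (c (T (i n)))%:R (c n)%:R (2^-1 ^+ i n) (2^-1 ^+ P) => a b D DP.
  move=> a0 DD HP HW D0 ab HWT.
  have CD0 : 0 <= C * D by apply: mulr_ge0; lra.
  have := ler_wpM2l CD0 ab.
  have : (C + 1) * D <= e by apply: le_trans HP; rewrite ler_wpM2l//; lra.
  move=> /(ler_wpM2r (le_trans a0 ab)); lra.
have s20 : 0 < s2 - s' by rewrite /s2; lra.
have [N HN] := vanishing_cst q (L (T 0%N)) s20.
exists (maxn N (T 0)) => n; rewrite geq_max => /andP[/HN Hn Tn].
have /andP[Tin nTi] := stairP Tmono Tn.
have [|_] := reg (i n) n; first by rewrite Tin ltnW.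
have := LT (i n); have := ler_norm (- L (T 0%N)); rewrite normrN.
rewrite /L; move: Hn; rewrite /L; lra.
Qed.

End Diagonal.

(** * Sums and entropy *)

Section Sums.
Variable R : realType.

Lemma sum_esum_disjoint (I : eqType) (T : choiceType) (a : T -> \bar R)
    (s : seq I) (S : I -> set T) (S0 : set T) :
  (forall x, 0 <= a x)%E -> uniq s ->
  (forall i, i \in s -> S i `<=` S0) ->
  (forall i j x, i \in s -> j \in s -> S i x -> S j x -> i = j) ->
  (\sum_(i <- s) \esum_(x in S i) a x <= \esum_(x in S0) a x)%E.
Proof.
move=> a0; elim: s S0 => [|i s IH] S0 /=; first by rewrite big_nil esum_ge0.
move=> /andP[si us] SS Sdisj; rewrite big_cons (esumID (S i) S0)//.
rewrite (setIidr (SS i _)) ?mem_head// leeD2l// IH//.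
- move=> j js x jx; split; first by apply: (SS j) => //; rewrite inE js orbT.
  move=> /Sdisj/(_ jx); rewrite !inE eqxx js orbT => /(_ isT isT) ij.
  by rewrite ij js in si.
- by move=> j k x js ks; apply: Sdisj; rewrite inE ?js ?ks orbT.
Qed.

Lemma exists_le_average (I : eqType) (f : I -> \bar R) (s : seq I) (C : \bar R) :
  (forall i, 0 <= f i)%E -> s != [::] -> (\sum_(i <- s) f i <= C)%E ->
  exists2 i, i \in s & ((size s)%:R%:E * f i <= C)%E.
Proof.
move=> f0 s0 sC.
have [i0 i0s i0min] : exists2 i0, i0 \in s & forall i, i \in s -> (f i0 <= f i)%E.
  elim: s s0 {sC} => // i [|j s] IH _.
    by exists i; rewrite ?mem_head// => k; rewrite inE => /eqP->.
  have [//|i0 i0s i0min] := IH; have [le|lt] := leP (f i0) (f i).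
    exists i0 => [|k]; first by rewrite inE i0s orbT.
    by rewrite inE => /predU1P[->//|/i0min].
  exists i => [|k]; first exact: mem_head.
  by rewrite inE => /predU1P[->//|/i0min]; apply: le_trans (ltW lt).
exists i0 => //; apply: le_trans sC; elim: s i0min {s0 i0s} => [|i s IH] i0min.
  by rewrite big_nil mul0e.
rewrite big_cons /= -natr1 EFinD ge0_muleDl ?lee_fin// mul1e addeC.
apply: leeD; first by apply: i0min; rewrite mem_head.
by apply: IH => j js; apply: i0min; rewrite inE js orbT.
Qed.

Lemma ler_sum_uniq (T : eqType) (F : T -> R) (s l : seq T) :
  (forall x, 0 <= F x) -> uniq s -> {subset s <= l} ->
  \sum_(x <- s) F x <= \sum_(x <- l) F x.
Proof.
move=> F0; elim: s l => [|x s IH] l /=; first by rewrite big_nil sumr_ge0.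
move=> /andP[xs us] sl; have xl : x \in l by apply: sl; rewrite mem_head.
rewrite (perm_big _ (perm_to_rem xl)) /= !big_cons lerD2l; apply: IH => // y ys.
apply: rem_mem; last by apply: sl; rewrite inE ys orbT.
by apply: contraNneq xs => <-.
Qed.

(** Double counting, used to bound the cost of finitely many cover words of various lengths level by
    level. *)
Lemma ler_sum_cover (T : eqType) (F : T -> R) (s : seq T) (N : nat)
    (L : nat -> seq T) (h : nat -> T -> R) :
  (forall n x, 0 <= h n x) -> uniq s ->
  (forall x, x \in s -> exists n, [/\ (n < N)%N, x \in L n & F x <= h n x]) ->
  \sum_(x <- s) F x <= \sum_(n < N) \sum_(x <- L n) h n x.
Proof.
move=> h0 us Hs.
apply: (@le_trans _ _ (\sum_(x <- s) \sum_(n < N | x \in L n) h n x)).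
  rewrite !big_seq; apply: ler_sum => x /Hs[n [nN xn]] /le_trans; apply.
  by rewrite (bigD1 (Ordinal nN))//= lerDl sumr_ge0.
rewrite (exchange_big_dep xpredT)//=; apply: ler_sum => n _.
rewrite -big_filter; apply: ler_sum_uniq => //; first by rewrite filter_uniq.
by move=> x; rewrite mem_filter => /andP[].
Qed.

Lemma sum_half_pow N : \sum_(n < N) 2^-1 ^+ n.+1 <= 1 :> R.
Proof.
suff -> : \sum_(n < N) 2^-1 ^+ n.+1 = 1 - 2^-1 ^+ N :> R.
  by rewrite lerBlDr lerDl exprn_ge0// invr_ge0.
by elim: N => [|N IH]; rewrite ?big_ord0 ?expr0 ?subrr// big_ord_recr /= IH exprS; lra.
Qed.

End Sums.

Section Entropy.
Variables (R : realType) (K : nat).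
Implicit Types (E : set (fullshift K)) (s : R).

Lemma cylinder_premeasure_nd s E :
  nondecreasing_seq (fun r => cylinder_premeasure s r E).
Proof.
move=> m n mn; apply: le_ereal_inf_tmp => _ [W [Wn WE] <-].
apply: ereal_inf_lbound; exists W => //; split=> // w /Wn; exact: leq_ltn_trans.
Qed.

Lemma cylinder_measureE s E :
  cylinder_measure s E = ereal_sup (range (fun r => cylinder_premeasure s r E)).
Proof. exact/cvg_lim/ereal_nondecreasing_cvgn/cylinder_premeasure_nd. Qed.

Lemma htop_ge s E : E !=set0 ->
  (forall t M : R, 0 <= t -> t < s -> exists r, (M%:E <= cylinder_premeasure t r E)%E) ->
  (s%:E <= htop R E)%E.
Proof.
move=> /set0P E0 H; rewrite /htop (negPf E0).
apply: le_ereal_inf_tmp => _ [t [t0 tE] <-]; rewrite lee_fin leNgt; apply/negP => ts.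
move: tE; rewrite cylinder_measureE; apply/negP; rewrite -leNgt leye_eq.
apply/eqP/eqyP => M _; have [r Mr] := H _ M t0 ts.
by apply: le_trans Mr _; apply: ereal_sup_ubound; exists r.
Qed.

Lemma htop_le s E (M : R) : E !=set0 -> 0 <= s ->
  (forall r, (cylinder_premeasure s r E <= M%:E)%E) -> (htop R E <= s%:E)%E.
Proof.
move=> /set0P E0 s0 H; rewrite /htop (negPf E0); apply: ereal_inf_lbound.
exists s => //; split=> //; rewrite cylinder_measureE.
by apply: (@le_lt_trans _ _ M%:E); rewrite ?ltry//; apply: ge_ereal_sup => _ [r _ <-].
Qed.

Lemma htop_ge0 E : E !=set0 -> (0 <= htop R E)%E.
Proof.
move=> /set0P E0; rewrite /htop (negPf E0).
by apply: le_ereal_inf_tmp => _ [t [t0 tE] <-]; rewrite lee_fin.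
Qed.

End Entropy.

(** * Block words *)

Definition words K (l : nat) : seq (seq 'I_K) :=
  [seq val t | t <- enum {: l.-tuple 'I_K}].

Lemma mem_words K l (w : seq 'I_K) : (w \in words K l) = (size w == l).
Proof.
apply/mapP/idP => [[t _ ->]|wl]; first by rewrite size_tuple.
by exists (Tuple wl) => //; rewrite mem_enum.
Qed.

Lemma words_uniq K l : uniq (words K l).
Proof. by rewrite map_inj_uniq ?enum_uniq//; apply: val_inj. Qed.

Lemma size_words K l : size (words K l) = (K ^ l)%N.
Proof. by rewrite size_map -cardE card_tuple card_ord. Qed.

Lemma sum_ltn_ord (R : numDomainType) (m p : nat) :
  \sum_(i < m) ((i < p)%N%:R : R) <= p%:R.
Proof.
rewrite -natr_sum ler_nat; suff -> : (\sum_(i < m) (i < p) = minn m p)%N.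
  exact: geq_minr.
by elim: m => [|m IH]; rewrite ?big_ord0 ?min0n// big_ord_recr /= IH; lia.
Qed.

Lemma sum_addn_ord (V : nmodType) (F : nat -> V) a b :
  \sum_(i < a + b) F i = \sum_(i < a) F i + \sum_(i < b) F (a + i)%N.
Proof. by rewrite big_split_ord. Qed.

Section Model.
Variables (R : realType) (K : nat) (A : 'M[nat]_K) (q : nat).
Local Notation T := (fullshift K).
Local Notation c := (bstart q).
Local Notation m := (blen q).

(** Paths of [q.+1] allowed transitions, hence with [q] symbols strictly between the endpoints. *)
Variable connect : 'I_K -> 'I_K -> nat -> 'I_K.
Hypothesis connect0 : forall a b, connect a b 0 = a.
Hypothesis connectq : forall a b, connect a b q.+1 = b.
Hypothesis connectA : forall a b i, (i <= q)%N ->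
  A (connect a b i) (connect a b i.+1) = 1%N.

Variable x0 : T.
Hypothesis x0A : sft A x0.

(** [d i] plays the role of the [i]-th potential composed with [i] shifts, after a normalisation
    making the family uniformly bounded. *)
Variables (d : nat -> T -> R) (B : R) (rho : nat -> R).
Hypothesis d_bound : forall i x, sft A x -> `|d i x| <= B.
Hypothesis d_var : forall i l x y, sft A x -> sft A y ->
  (forall j, (i <= j < i + l)%N -> x j = y j) -> `|d i x - d i y| <= rho l.
Hypothesis rho0 : forall e, 0 < e -> exists N, forall l, (N <= l)%N -> rho l <= e.

Lemma B_ge0 : 0 <= B.
Proof. exact: le_trans (normr_ge0 _) (d_bound 0 x0A). Qed.

Definition word k (x : T) : seq 'I_K := mkseq (fun i => x (c k + q + i)%N) k.+1.

Lemma size_word k x : size (word k x) = k.+1.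
Proof. exact: size_mkseq. Qed.

Lemma word_eqP k x y :
  word k x = word k y <-> forall j, (c k + q <= j < c k.+1)%N -> x j = y j.
Proof.
split=> [xy j jk|xy].
  have jE : j = (c k + q + (j - (c k + q)))%N by lia.
  have jlt : (j - (c k + q) < k.+1)%N by move: jk; rewrite bstartS /blen; lia.
  have := congr1 (fun w => nth (x 0%N) w (j - (c k + q))%N) xy.
  by rewrite !nth_mkseq// -jE.
apply: (@eq_from_nth _ (x 0%N)); rewrite !size_mkseq// => i ik.
by rewrite !nth_mkseq// xy// bstartS /blen; lia.
Qed.

Definition admissible k (w : seq 'I_K) := `[< exists2 x, sft A x & word k x = w >].

Lemma word_admissible k x : sft A x -> admissible k (word k x).
Proof. by move=> xA; apply/asboolP; exists x. Qed.

(** The default [x0] keeps the representative in the subshift, so [value] is bounded for every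
    word. *)
Definition representative k w : T :=
  match pselect (exists2 x, sft A x & word k x = w) with
  | left ex => s2val (cid2 ex)
  | right _ => x0
  end.

Lemma representative_sft k w : sft A (representative k w).
Proof. by rewrite /representative; case: pselect => // ex; case: (cid2 ex). Qed.

Lemma representative_word k w :
  admissible k w -> word k (representative k w) = w.
Proof.
by move=> /asboolP ex; rewrite /representative; case: pselect => // ex'; case: (cid2 ex').
Qed.

Definition block_sum k (x : T) : R := \sum_(i < m k) d (c k + i) x.

Lemma sum_block_sum n x : \sum_(k < n) block_sum k x = \sum_(i < c n) d i x.
Proof.
elim: n => [|n IH]; first by rewrite bstart0 !big_ord0.
by rewrite big_ord_recr IH bstartS (sum_addn_ord (d^~ x)).
Qed.

Lemma block_sum_bound k x : sft A x -> `|block_sum k x| <= B * (m k)%:R.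
Proof.
move=> xA; apply: (le_trans (ler_norm_sum _ _ _)).
apply: (@le_trans _ _ (\sum_(i < m k) B)); first by apply: ler_sum => i _; apply: d_bound.
by rewrite sumr_const card_ord mulr_natr.
Qed.

(** Positions among the first [q] or the last [N] of the block cost at most [2 * B] each. From any
    other position the two points agree on a window longer than [N], which costs at most [e]. *)
Lemma block_sum_close (e : R) : 0 < e -> exists2 C, 0 <= C &
  forall k x y, sft A x -> sft A y -> word k x = word k y ->
  `|block_sum k x - block_sum k y| <= C + e * (m k)%:R.
Proof.
move=> e0; have [N HN] := rho0 e0; have B0 := B_ge0.
exists (2 * B * (q + N)%:R) => [|k x y xA yA /word_eqP xy]; first by rewrite !mulr_ge0.
rewrite -sumrB; apply: (le_trans (ler_norm_sum _ _ _)).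
apply: (@le_trans _ _ (\sum_(i < m k)
   (2 * B * ((i < q)%N%:R + (rev_ord i < N)%N%:R) + e))).
  apply: ler_sum => i _; have dB : `|d (c k + i) x - d (c k + i) y| <= 2 * B.
    by apply: (le_trans (ler_normB _ _)); have := d_bound (c k + i) xA;
       have := d_bound (c k + i) yA; lra.
  case: ltnP => iq /=; first by case: ltnP => _ /=; lra.
  case: ltnP => iN /=; first lra.
  rewrite addr0 mulr0 add0r.
  apply: (le_trans (d_var (l := m k - i) xA yA _)) => [j jk|].
    by apply: xy; rewrite bstartS; have := ltn_ord i; lia.
  by apply: HN; have := ltn_ord i; lia.
rewrite big_split /= sumr_const card_ord -[e *+ _]mulr_natr lerD2r -mulr_sumr.
rewrite big_split /= natrD ler_wpM2l ?mulr_ge0// lerD ?sum_ltn_ord//.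
change (\sum_(i < m k) ((rev_ord i < N)%N%:R : R) <= N%:R).
rewrite (reindex_inj rev_ord_inj); under eq_bigr do rewrite rev_ordK.
exact: sum_ltn_ord.
Qed.

Definition value k w : R := block_sum k (representative k w).

Lemma value_bound k w : `|value k w| <= B * (m k)%:R.
Proof. exact/block_sum_bound/representative_sft. Qed.

(** The constant of [block_sum_close] is paid once per block, which is negligible in total, and its
    slope is arbitrarily small. *)
Lemma vanishing_value (u : nat -> T) x : sft A x ->
  (forall k, sft A (u k)) -> (forall k, word k x = word k (u k)) ->
  vanishing q (fun n => \sum_(k < n) (block_sum k x - value k (word k (u k)))).
Proof.
move=> xA uA xu e e0; have e20 : 0 < e / 2 by lra.
have [C C0 HC] := block_sum_close e20.
have [N HN] := vanishingZ C (@vanishing_natr R q) e20.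
exists N => n /HN; rewrite ger0_norm ?mulr_ge0// => Hn.
apply: (le_trans (ler_norm_sum _ _ _)).
apply: (@le_trans _ _ (\sum_(k < n) (C + e / 2 * (m k)%:R))).
  apply: ler_sum => k _; apply: HC => //; first exact: representative_sft.
  by rewrite representative_word ?xu//; apply: word_admissible.
rewrite big_split /= sumr_const card_ord -mulr_sumr -natr_sum -/(c n) -mulr_natr.
lra.
Qed.

(** Convergence of the averages to [b], with the division by [n] cleared. *)
Definition level (b : R) : set T := [set x | sft A x /\ forall e, 0 < e ->
  exists N, forall n, (N <= n)%N -> `|\sum_(i < n) d i x - b * n%:R| <= e * n%:R].

Lemma sum_blockB b n x :
  \sum_(k < n) (block_sum k x - b * (m k)%:R) =
  \sum_(i < c n) d i x - b * (c n)%:R.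
Proof. by rewrite sumrB sum_block_sum -mulr_sumr -natr_sum. Qed.

Lemma level_vanishing b x : level b x ->
  vanishing q (fun n => \sum_(k < n) (block_sum k x - b * (m k)%:R)).
Proof.
move=> [_ H] e /H[N HN]; exists N => n Nn; rewrite sum_blockB; apply: HN.
exact: leq_trans Nn (leq_bstart q n).
Qed.

(** It suffices to control the sums at block boundaries: inside a block they move by at most
    [B + |b|] times its length, which is negligible. *)
Lemma vanishing_level b x : sft A x ->
  vanishing q (fun n => \sum_(k < n) (block_sum k x - b * (m k)%:R)) -> level b x.
Proof.
move=> xA H; split=> // e e0; have e20 : 0 < e / 2 by lra.
have [N1 H1] := H _ e20.
have [N2 H2] := vanishingZ (B + `|b|) (@vanishing_blen R q) e20.
exists (c (maxn N1 N2)) => j Nj.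
have /andP[nj jn] := block_indexP q j.
move: nj jn; set n := block_index q j => nj jn.
have : (maxn N1 N2 <= n)%N by rewrite -ltnS -(ltn_bstart q) (leq_ltn_trans Nj).
rewrite geq_max => /andP[/H1 {}H1 /H2 {}H2]; rewrite sum_blockB in H1.
rewrite ger0_norm ?mulr_ge0 ?addr_ge0 ?B_ge0// in H2.
have jE : j = (c n + (j - c n))%N by lia.
have rest : `|\sum_(i < j - c n) d (c n + i) x| <= B * (m n)%:R.
  apply: (le_trans (ler_norm_sum _ _ _)).
  apply: (@le_trans _ _ (\sum_(i < j - c n) B)).
    by apply: ler_sum => i _; apply: d_bound.
  rewrite sumr_const card_ord -[B *+ _]mulr_natr ler_wpM2l ?B_ge0// ler_nat.
  by move: jn; rewrite bstartS; lia.
have restb : `|b * (j - c n)%:R| <= `|b| * (m n)%:R.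
  rewrite normrM ler_wpM2l// ger0_norm// ler_nat.
  by move: jn; rewrite bstartS; lia.
have cj : (c n)%:R <= j%:R :> R by rewrite ler_nat.
have -> : \sum_(i < j) d i x =
    \sum_(i < c n) d i x + \sum_(i < j - c n) d (c n + i) x.
  by rewrite -(sum_addn_ord (d^~ x)) -jE.
rewrite [X in b * X%:R]jE natrD mulrDr.
rewrite opprD addrACA; apply: (le_trans (ler_normD _ _)).
have := ler_normB (\sum_(i < j - c n) d (c n + i) x) (b * (j - c n)%:R).
have := ler_wpM2l (ltW e20) cj; lra.
Qed.

(** * Neighbouring words and good pairs *)

Definition admissible_words k := [seq w <- words K k.+1 | admissible k w].

Lemma mem_admissible_words k w : (w \in admissible_words k) = admissible k w.
Proof.
rewrite mem_filter mem_words andb_idr// => /asboolP[x _ <-].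
by rewrite size_word.
Qed.

(** A tolerance of 1 per block adds up to at most the number of blocks, which is negligible, yet
    leaves only linearly many classes of values in the block length. *)
Definition neighbours k w :=
  [seq v <- admissible_words k | `|value k v - value k w| <= 1].

Definition multiplicity k w := size (neighbours k w).

Lemma mem_neighbours k w v :
  (v \in neighbours k w) = (`|value k v - value k w| <= 1) && admissible k v.
Proof. by rewrite mem_filter mem_admissible_words. Qed.

Lemma neighbours_uniq k w : uniq (neighbours k w).
Proof. by rewrite !filter_uniq// words_uniq. Qed.

Lemma multiplicity_gt0 k w : admissible k w -> (0 < multiplicity k w)%N.
Proof.
move=> wk; rewrite -has_predT; apply/hasP; exists w => //.
by rewrite mem_neighbours subrr normr0 ler01.
Qed.

Definition lam k w : R := ln (multiplicity k w)%:R.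

Lemma lam_ge0 k w : admissible k w -> 0 <= lam k w.
Proof.
by move=> wk; rewrite ln_ge0// -[1]/(1%:R) ler_nat multiplicity_gt0.
Qed.

Lemma lam_le k w : admissible k w -> lam k w <= ln K%:R * (m k)%:R.
Proof.
move=> wk; have w0 := multiplicity_gt0 wk.
have K0 : (0 < K)%N by move: (x0 0%N) => /= a; apply: leq_ltn_trans (ltn_ord a).
have wK : (multiplicity k w <= K ^ m k)%N.
  apply: (@leq_trans (K ^ k.+1)); last by rewrite leq_pexp2l// /blen leq_addl.
  rewrite -size_words /multiplicity size_filter (leq_trans (count_size _ _))//.
  by rewrite size_filter count_size.
rewrite mulr_natr -lnXn ?ltr0n// -natrX ler_ln ?posrE ?ltr0n ?expn_gt0 ?K0//.
by rewrite ler_nat.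
Qed.

(* [b] is the mean value and [s] a lower bound for the growth rate of the number
   of sequences of neighbouring words. *)
Definition good (b s : R) := exists u : nat -> T,
  [/\ forall k, sft A (u k),
      vanishing q (fun n => \sum_(k < n) (value k (word k (u k)) - b * (m k)%:R)) &
      exists N, forall n, (N <= n)%N ->
        s * (c n)%:R <= \sum_(k < n) lam k (word k (u k))].

Lemma level_value b x : level b x ->
  vanishing q (fun n => \sum_(k < n) (value k (word k x) - b * (m k)%:R)).
Proof.
move=> xb; have xA : sft A x by case: xb.
have := vanishingD (level_vanishing xb)
  (vanishingZ (-1) (@vanishing_value (fun=> x) x xA (fun=> xA) (fun=> erefl))).
apply: vanishing_eq => n; rewrite mulN1r -sumrB; apply: eq_bigr => k _; ring.
Qed.

Lemma level_good b x s : level b x ->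
  (exists N, forall n, (N <= n)%N -> s * (c n)%:R <= \sum_(k < n) lam k (word k x)) ->
  good b s.
Proof.
by move=> xb H; exists (fun=> x); split=> //; [case: xb | apply: level_value].
Qed.

Lemma good_conv a b s s' t e : 0 <= t <= 1 -> 0 < e -> good a s -> good b s' ->
  good (t * a + (1 - t) * b) (t * s + (1 - t) * s' - e).
Proof.
move=> t01 e0 [u [uA uv [N1 H1]]] [v [vA vv [N2 H2]]].
(* A common bound per symbol for the differences of values and of [lam]. *)
pose C := 2 * B + ln K%:R.
have K1 : 0 <= ln K%:R :> R.
  apply: ln_ge0; rewrite -[1]/(1%:R) ler_nat.
  by move: (x0 0%N) => /= i; apply: leq_ltn_trans (ltn_ord i).
pose x k := value k (word k (u k)) - value k (word k (v k)).
pose y k := lam k (word k (u k)) - lam k (word k (v k)).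
have xC k : `|x k| <= C * (m k)%:R.
  apply: (le_trans (ler_normB _ _)).
  have := value_bound k (word k (u k)); have := value_bound k (word k (v k)).
  have : 0 <= ln K%:R * (m k)%:R :> R by rewrite mulr_ge0.
  rewrite /C; lra.
have yC k : `|y k| <= C * (m k)%:R.
  have := lam_ge0 (word_admissible k (uA k)); have := lam_ge0 (word_admissible k (vA k)).
  have := lam_le (word_admissible k (uA k)); have := lam_le (word_admissible k (vA k)).
  have : 0 <= B * (m k)%:R by rewrite mulr_ge0// B_ge0.
  by rewrite /C /y ler_norml; lra.
have [z [zx zy]] := selection t01 xC yC.
exists (fun k => if z k then u k else v k); split.
- by move=> k; case: (z k).
- have := vanishingD zx (vanishingD (vanishingZ t uv) (vanishingZ (1 - t) vv)).
  apply: vanishing_eq => n; rewrite !mulr_sumr -!big_split /=; apply: eq_bigr => k _.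
  by rewrite /x; case: (z k) => /=; ring.
- have [N3 H3] := zy _ e0; exists (maxn N1 (maxn N2 N3)) => n.
  rewrite !geq_max => /and3P[/H1 {}H1 /H2 {}H2 /H3 {}H3].
  have -> : \sum_(k < n) lam k (word k (if z k then u k else v k)) =
      \sum_(k < n) ((z k)%:R - t) * y k + (t * \sum_(k < n) lam k (word k (u k)) +
      (1 - t) * \sum_(k < n) lam k (word k (v k))).
    rewrite !mulr_sumr -!big_split /=; apply: eq_bigr => k _.
    by rewrite /y; case: (z k) => /=; ring.
  move: t01 => /andP[t0 t1]; have t1' : 0 <= 1 - t by lra.
  have := ler_wpM2l t0 H1; have := ler_wpM2l t1' H2.
  move: H3; rewrite ler_norml => /andP[+ _]; lra.
Qed.

Lemma good_limit b s s' : s' < s ->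
  (forall e, 0 < e -> exists2 a, `|a - b| <= e & good a s) -> good b s'.
Proof.
move=> ss' H.
have : forall p, exists u : nat -> T, (forall k, sft A (u k)) /\
   (exists N, forall n, (N <= n)%N ->
     `|\sum_(k < n) (value k (word k (u k)) - b * (m k)%:R)| <=
       2^-1 ^+ p / 2 * (c n)%:R) /\
   (exists N, forall n, (N <= n)%N ->
        s * (c n)%:R <= \sum_(k < n) lam k (word k (u k))).
  (* One quarter is for the error around [a], the other for replacing [a] by [b]; their sum is the
     half required by [diagonal_regimes]. *)
  move=> p; have d0 : 0 < 2^-1 ^+ p / 4 :> R.
    by rewrite divr_gt0// exprn_gt0// invr_gt0.
  have [a ab [u [uA uv ul]]] := H _ d0; exists u; split=> //; split=> //.
  have [N HN] := uv _ d0; exists N => n /HN {}HN.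
  have -> : \sum_(k < n) (value k (word k (u k)) - b * (m k)%:R) =
      \sum_(k < n) (value k (word k (u k)) - a * (m k)%:R) + (a - b) * (c n)%:R.
    rewrite /bstart natr_sum mulr_sumr -big_split /=; apply: eq_bigr => k _; ring.
  apply: (le_trans (ler_normD _ _)); rewrite normrM [`|(c n)%:R|]ger0_norm//.
  have := ler_wpM2r (ler0n R (c n)) ab; lra.
move=> /choice[u Hu].
have [i [i1 i2]] := @diagonal_regimes R q
  (fun p k => value k (word k (u p k)) - b * (m k)%:R)
  (fun p k => lam k (word k (u p k))) s s' ss'
  (fun p => (Hu p).2.1) (fun p => (Hu p).2.2).
by exists (fun k => u (i k) k); split=> // k; apply: (Hu _).1.
Qed.

(* The first [q] symbols of every block but the initial one are connectors. *)
Definition glue (u : nat -> T) : T := fun j =>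
  let k := block_index q j in
  if (0 < k)%N && (j < c k + q)%N then
    connect (u k.-1 (c k).-1) (u k (c k + q)%N) (j - c k).+1
  else u k j.

Lemma glue_kept u k j : (c k + q <= j < c k.+1)%N -> glue u j = u k j.
Proof.
move=> jk; rewrite /glue (@block_indexE q k); last by lia.
by rewrite [(j < _)%N]ltnNge; move: jk => /andP[-> _]; rewrite andbF.
Qed.

Lemma glue0 u j : (j < c 1)%N -> glue u j = u 0%N j.
Proof. by move=> j1; rewrite /glue (@block_indexE q 0) ?bstart0. Qed.

(** A junction is an entire path of [connect]: index 0 is the last symbol of block [k], index [q.+1]
    the first kept symbol of block [k.+1]. *)
Lemma glue_connect u k i : (i <= q.+1)%N ->
  glue u ((c k.+1).-1 + i)%N = connect (u k (c k.+1).-1) (u k.+1 (c k.+1 + q)%N) i.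
Proof.
have c0 : (0 < c k.+1)%N by rewrite bstartS /blen; lia.
case: i => [_|i iq].
  by rewrite connect0 addn0; apply: glue_kept; rewrite bstartS /blen; lia.
have -> : ((c k.+1).-1 + i.+1 = c k.+1 + i)%N by lia.
have := bstartS q k.+1; rewrite /blen => cS.
move: iq; rewrite ltnS leq_eqVlt => /orP[/eqP->|iq].
  by rewrite connectq; apply: glue_kept; lia.
rewrite /glue (@block_indexE q k.+1); last by lia.
by rewrite ltn_add2l iq /= addKn.
Qed.

Lemma glue_sft u : (forall k, sft A (u k)) -> sft A (glue u).
Proof.
move=> uA j; have /andP[kj jk] := block_indexP q j.
move: kj jk; set k := block_index q j => kj jk.
(* The transition at [j] leaves block [k], or lies in its kept word, or in the uncut initial block,
   or inside a junction. *)
have [jS|jS] := eqVneq j.+1 (c k.+1).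
  have jE : j = ((c k.+1).-1 + 0)%N by rewrite -jS addn0.
  have jE1 : j.+1 = ((c k.+1).-1 + 1)%N by rewrite -jS addn1.
  by rewrite {1}jE jE1 !glue_connect// connectA.
have [jq|jq] := leqP (c k + q) j.
  by rewrite !(@glue_kept u k)//; try lia; apply: uA.
case: k kj jk jS jq => [|k] kj jk jS jq.
  by rewrite !glue0//; try lia; apply: uA.
have c0 : (0 < c k.+1)%N by rewrite bstartS /blen; lia.
have jE : j = ((c k.+1).-1 + (j - c k.+1).+1)%N by lia.
have jE1 : j.+1 = ((c k.+1).-1 + (j - c k.+1).+2)%N by lia.
by rewrite {1}jE jE1 !glue_connect ?connectA//; lia.
Qed.

Lemma glue_word u k : word k (glue u) = word k (u k).
Proof. by apply/word_eqP => j jk; apply: glue_kept. Qed.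

(** A symbol depends only on the choices for its own block and the preceding one. *)
Lemma glue_local u v n : (forall k, (k < n)%N -> u k = v k) ->
  forall j, (j < c n)%N -> glue u j = glue v j.
Proof.
move=> uv j jn; have /andP[kj _] := block_indexP q j.
have kn : (block_index q j < n)%N.
  by rewrite -(ltn_bstart q) (leq_ltn_trans kj).
by rewrite /glue !uv//; apply: leq_ltn_trans (leq_pred _) kn.
Qed.

(** Three negligible errors add up: from the glued point to the values of [v], from these to the
    values of [u], and from there to [b]. *)
Lemma glue_level b (u v : nat -> T) : (forall k, sft A (u k)) ->
  vanishing q (fun n => \sum_(k < n) (value k (word k (u k)) - b * (m k)%:R)) ->
  (forall k, sft A (v k)) ->
  (forall k, word k (v k) \in neighbours k (word k (u k))) ->
  level b (glue v).
Proof.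
move=> uA ub vA vu; apply: vanishing_level; first exact: glue_sft.
have gv := vanishing_value (glue_sft vA) vA (glue_word v).
have vu' : vanishing q (fun n => \sum_(k < n)
    (value k (word k (v k)) - value k (word k (u k)))).
  apply: vanishing_le (@vanishing_natr R q) => n.
  apply: (le_trans (ler_norm_sum _ _ _)).
  apply: (@le_trans _ _ (\sum_(i < n) 1)); last by rewrite sumr_const card_ord.
  by apply: ler_sum => k _; have := vu k; rewrite mem_neighbours => /andP[].
have := vanishingD gv (vanishingD vu' ub).
by apply: vanishing_eq => n; rewrite -!big_split; apply: eq_bigr => k _ /=; ring.
Qed.

Lemma good_level b s : good b s -> level b !=set0.
Proof.
move=> [u [uA ub _]]; exists (glue u); apply: (glue_level uA ub uA) => k.
by rewrite mem_neighbours subrr normr0 ler01 word_admissible.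
Qed.

(** * Lower bound for the entropy of a level set *)

Section EntropyLowerBound.
Variables (b : R) (u : nat -> T).
Hypothesis uA : forall k, sft A (u k).
Hypothesis ub : vanishing q
  (fun n => \sum_(k < n) (value k (word k (u k)) - b * (m k)%:R)).

Let near (v : nat -> T) :=
  forall k, sft A (v k) /\ word k (v k) \in neighbours k (word k (u k)).

Let near_u : near u.
Proof.
by move=> k; split=> //; rewrite mem_neighbours subrr normr0 ler01 word_admissible.
Qed.

(** The cover words whose cylinders lie inside the cylinder of the first [n] blocks of [glue v];
    their total cost is what remains at stage [n]. *)
Definition extensions (W : set (seq 'I_K)) n v : set (seq 'I_K) :=
  W `&` [set w | (c n <= size w)%N /\ take (c n) w = mkseq (glue v) (c n)].

Lemma take_glue n v (w : seq 'I_K) : (n <= size w)%N ->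
  take n w = mkseq (glue v) n <-> forall j, (j < n)%N -> nth (x0 0%N) w j = glue v j.
Proof.
move=> nw; split=> [wv j jn|wv].
  by rewrite -(nth_take _ jn) wv nth_mkseq.
apply: (@eq_from_nth _ (x0 0%N)); first by rewrite size_takel// size_mkseq.
by move=> j; rewrite size_takel// => jn; rewrite nth_take// nth_mkseq// wv.
Qed.

(* Replacing the [n]-th word by each of its neighbours splits the extensions of
   [v] into disjoint parts, so one of them has at most the average cost. *)
Lemma exists_cheap_child (W : set (seq 'I_K)) (a : seq 'I_K -> \bar R) n v :
  (forall w, 0 <= a w)%E -> near v ->
  exists v', [/\ near v', forall k, k != n -> v' k = v k &
    ((multiplicity n (word n (u n)))%:R%:E * (\esum_(w in extensions W n.+1 v') a w)
      <= (\esum_(w in extensions W n v) a w))%E].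
Proof.
move=> a0 vu; pose s := neighbours n (word n (u n)).
pose upd w k := if k == n then representative n w else v k.
have sadm w : w \in s -> admissible n w by rewrite mem_neighbours => /andP[].
have upd_near w : w \in s -> near (upd w).
  move=> ws k; rewrite /upd; case: eqVneq => [->|_]; last exact: vu.
  by split; [exact: representative_sft | rewrite representative_word ?sadm].
have nc : (c n <= c n.+1)%N by rewrite bstartS leq_addr.
have [|||w ws Hw] := @exists_le_average _ _
    (fun w => \esum_(x in extensions W n.+1 (upd w)) a x)%E s
    (\esum_(w in extensions W n v) a w)%E.
- by move=> w; apply: esum_ge0.
- by rewrite -size_eq0 -lt0n multiplicity_gt0// word_admissible.
- apply: sum_esum_disjoint => //; first exact: neighbours_uniq.
    move=> w ws x [Wx [nx /(take_glue _ nx) xw]]; split=> //; split.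
      exact: leq_trans nx.
    apply/take_glue => [|j jn]; first exact: leq_trans nx.
    rewrite xw; last exact: leq_trans nc.
    by apply: glue_local jn => k kn; rewrite /upd ltn_eqF.
  move=> w w' x ws w's [_ [nx /(take_glue _ nx) xw]] [_ [_ /(take_glue _ nx) xw']].
  have E y : y \in s -> word n (glue (upd y)) = y.
    by move=> ys; rewrite glue_word /upd eqxx representative_word// sadm.
  rewrite -(E w)// -(E w')//; apply/word_eqP => j /andP[_ jn].
  by rewrite -xw// -xw'.
- exists (upd w); split=> // [|k kn]; first exact: upd_near.
  by rewrite /upd (negPf kn).
Qed.

(** Iterating [exists_cheap_child] changes only the [n]-th entry at stage [n], so the stages
    stabilise to a sequence [v], and each block divides the remaining cost by its multiplicity. *)
Lemma exists_uncovered (W : set (seq 'I_K)) (a : seq 'I_K -> \bar R) :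
  (forall w, 0 <= a w)%E -> exists2 v, near v & forall n,
    ((\prod_(k < n) multiplicity k (word k (u k)))%:R%:E *
     (\esum_(w in extensions W n v) a w) <= (\esum_(w in W) a w))%E.
Proof.
move=> a0.
have : forall nv : nat * (nat -> T), exists v', near nv.2 ->
  [/\ near v', forall k, k != nv.1 -> v' k = nv.2 k &
    ((multiplicity nv.1 (word nv.1 (u nv.1)))%:R%:E *
      (\esum_(w in extensions W nv.1.+1 v') a w)
      <= (\esum_(w in extensions W nv.1 nv.2) a w))%E].
  move=> [n v]; have [vu|nvu] := pselect (near v); last by exists v.
  by have [v' ?] := exists_cheap_child W n a0 vu; exists v'.
move=> /choice[g Hg]; pose fix vs n := if n is n'.+1 then g (n', vs n') else u.
have vsP n : near (vs n).
  by elim: n => [|n IH] /=; [exact: near_u | have [] := Hg (n, vs n) IH].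
have vsS n k : k != n -> vs n.+1 k = vs n k.
  by move=> kn; have [_ /(_ k kn)] := Hg (n, vs n) (vsP n).
pose v k := vs k.+1 k.
have vE n k : (k < n)%N -> v k = vs n k.
  elim: n => // n IH; rewrite ltnS leq_eqVlt => /predU1P[->//|kn].
  by rewrite vsS ?IH// ltn_eqF.
exists v => [k|n]; first exact: vsP.
have -> : extensions W n v = extensions W n (vs n).
  congr (W `&` _); apply/seteqP; split=> w [nw wv]; split=> //; rewrite wv;
    apply/eq_in_map => j; rewrite mem_iota => /= jn;
    by apply: glue_local jn => k kn; rewrite (vE n).
elim: n => [|n IH].
  rewrite big_ord0 mul1e /extensions bstart0 (_ : W `&` _ = W)//.
  by apply/seteqP; split=> [w []//|w Ww]; split=> //=; rewrite take0.
rewrite big_ord_recr /= natrM EFinM -muleA; apply: le_trans IH.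
rewrite lee_wpmul2l ?lee_fin//; have [_ _ ] := Hg (n, vs n) (vsP n); exact.
Qed.

Lemma level_premeasure_ge s t M : 0 <= t -> t < s ->
  (exists N, forall n, (N <= n)%N -> s * (c n)%:R <= \sum_(k < n) lam k (word k (u k))) ->
  exists r, (M%:E <= cylinder_premeasure t r (level b))%E.
Proof.
(* Half of the gap [s - t] pays for [M], the other half for the part of the covering word beyond its
   last complete block. *)
move=> t0 ts [N1 H1]; have e0 : 0 < (s - t) / 2 by lra.
have [N2 H2] := vanishing_cst q M e0.
have [N3 H3] := vanishingZ t (@vanishing_blen R q) e0.
pose N := maxn N1 (maxn N2 N3); exists (c N).
apply: le_ereal_inf_tmp => _ [W [Wlong Wcov] <-].
pose a (w : seq 'I_K) : \bar R := (expR (- t * (size w)%:R))%:E.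
have a0 w : (0 <= a w)%E by rewrite lee_fin expR_ge0.
have [v vu Hv] := exists_uncovered W a0.
have xL : level b (glue v).
  by apply: (glue_level uA ub) => k; case: (vu k).
have [w Ww xw] := Wcov _ xL.
have /andP[nw wn] := block_indexP q (size w).
move: nw wn; set n := block_index q (size w) => nw wn.
have Nn : (N <= n)%N.
  by rewrite -ltnS -(ltn_bstart q) (leq_ltn_trans (ltnW (Wlong _ Ww))).
(* The word covering [glue v] belongs to the remaining cost, so the total cost is at least [a w]
   times the product of the multiplicities. *)
have aw : (a w <= (\esum_(w in extensions W n v) a w))%E.
  apply: esum_ge; exists [set w]; last by rewrite fsbig_set1.
  split; first exact: finite_set1.
  move=> _ ->; split=> //; split=> //; apply/take_glue => // j jn.
  by rewrite -[w in nth _ w]xw nth_mkseq// (leq_trans jn).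
apply: le_trans (Hv n); apply: (@le_trans _ _
  ((\prod_(k < n) multiplicity k (word k (u k)))%:R%:E * a w)%E); last first.
  by rewrite lee_wpmul2l ?lee_fin.
have -> : (\prod_(k < n) multiplicity k (word k (u k)))%:R =
    expR (\sum_(k < n) lam k (word k (u k))) :> R.
  rewrite expR_sum natr_prod; apply: eq_bigr => k _.
  by rewrite lnK// posrE ltr0n multiplicity_gt0// word_admissible.
rewrite -EFinM -expRD lee_fin; apply: le_trans (expR_ge1Dx _).
move: Nn; rewrite !geq_max => /and3P[/H1 {}H1 /H2 {}H2 /H3 {}H3].
have := ler_norm M; have := ler_norm (t * (m n)%:R).
have : (size w)%:R <= (c n)%:R + (m n)%:R :> R.
  by rewrite -natrD -bstartS ler_nat ltnW.
move=> /(ler_wpM2l t0); rewrite mulrDr mulNr; lra.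
Qed.

End EntropyLowerBound.

Lemma good_htop b s : good b s -> (s%:E <= htop R (level b))%E.
Proof.
move=> bs; apply: htop_ge; first exact: good_level bs.
by case: bs => u [uA ub us] t M t0 ts; apply: level_premeasure_ge us.
Qed.

(** * Upper bound for the entropy of a level set *)

Section EntropyUpperBound.

Definition subword k (w : seq 'I_K) := take k.+1 (drop (c k + q) w).

Lemma subword_mkseq n k x : (k < n)%N -> subword k (mkseq x (c n)) = word k x.
Proof.
move=> kn; have : (c k.+1 <= c n)%N by rewrite (stair_mono (@ltn_bstart q)).
rewrite bstartS /blen => kc; apply: (@eq_from_nth _ (x 0%N)).
  by rewrite size_takel ?size_drop size_mkseq//; lia.
move=> i; rewrite size_takel ?size_drop ?size_mkseq; last by lia.
by move=> ik; rewrite nth_take// nth_drop !nth_mkseq//; lia.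
Qed.

(** Contains all prefixes of length [c n] of points of the subshift. Leaving the first [q] symbols
    of each block arbitrary gives the product structure needed for [sum_weight]. *)
Fixpoint block_words n : seq (seq 'I_K) :=
  if n is k.+1 then
    [seq w ++ p | w <- block_words k,
       p <- [seq z ++ v | z <- words K q, v <- admissible_words k]]
  else [:: [::]].

Lemma size_block_words n w : w \in block_words n -> size w = c n.
Proof.
elim: n w => [|n IH] w /=; first by rewrite inE bstart0 => /eqP->.
case/allpairsP => -[w' p] [/= /IH w'n /allpairsP[[z v] [/= + + ->]] ->].
rewrite mem_words mem_admissible_words => /eqP zq /asboolP[y _ <-].
by rewrite !size_cat w'n zq size_word bstartS.
Qed.

Lemma mkseqD (U : Type) (f : nat -> U) i j :
  mkseq f (i + j) = mkseq f i ++ mkseq (fun k => f (i + k)%N) j.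
Proof. by rewrite /mkseq iotaD map_cat add0n -{2}[i]addn0 iotaDl -map_comp. Qed.

Lemma mem_block_words n x : sft A x -> mkseq x (c n) \in block_words n.
Proof.
move=> xA; elim: n => [|n IH] /=; first by rewrite bstart0.
rewrite bstartS /blen mkseqD mkseqD; apply: allpairs_f => //.
apply: allpairs_f; first by rewrite mem_words size_mkseq.
rewrite mem_admissible_words; apply/asboolP; exists x => //.
by apply: eq_mkseq => i; rewrite addnA.
Qed.

(* Words whose values fall in the same unit interval are neighbours of each
   other, so each such interval contributes at most 1. *)
Lemma sum_inv_multiplicity k :
  \sum_(w <- admissible_words k) expR (- lam k w) <= 2 * B * (m k)%:R + 1.
Proof.
have B0 := B_ge0.
pose t w := Num.truncn (value k w + B * (m k)%:R).
pose P := Num.truncn (2 * B * (m k)%:R).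
have v0 w : 0 <= value k w + B * (m k)%:R.
  by have := value_bound k w; rewrite ler_norml; lra.
have tP w : (t w < P.+1)%N.
  rewrite ltnS /t /P; apply: le_truncn.
  by have := value_bound k w; rewrite ler_norml; lra.
rewrite (partition_big (fun w => Ordinal (tP w)) xpredT)//=.
apply: (@le_trans _ _ (\sum_(j < P.+1) 1)); last first.
  rewrite sumr_const card_ord -(natr1 P) lerD2r.
  by have /andP[] := truncn_itv (mulr_ge0 (mulr_ge0 (ler0n R 2) B0) (ler0n R (m k))).
apply: ler_sum => j _; rewrite -big_filter; set l := [seq _ <- _ | _].
have [->|l0] := eqVneq l [::]; first by rewrite big_nil.
have ls : 0 < (size l)%:R :> R by rewrite ltr0n lt0n size_eq0.
apply: (@le_trans _ _ (\sum_(w <- l) (size l)%:R^-1)); last first.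
  by rewrite big_const_seq count_predT iter_addr_0 -[_ *+ _]mulr_natr mulVf ?gt_eqF.
rewrite !big_seq; apply: ler_sum => w wl.
have lw : (size l <= multiplicity k w)%N.
  apply: uniq_leq_size; first by rewrite !filter_uniq// words_uniq.
  move: wl; rewrite mem_filter => /andP[/eqP wj wadm].
  move=> v; rewrite mem_filter => /andP[/eqP vj vadm].
  rewrite mem_neighbours -mem_admissible_words vadm andbT.
  have tvw : t v = t w by have := congr1 val (etrans vj (esym wj)).
  have := truncn_itv (v0 v); have := truncn_itv (v0 w).
  rewrite -/(t v) -/(t w) tvw -natr1 => /andP[? ?] /andP[? ?].
  by rewrite ler_norml; lra.
rewrite expRN lef_pV2 ?posrE ?expR_gt0//.
rewrite lnK ?ler_nat// posrE ltr0n (leq_trans _ lw)//.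
by rewrite -(@ltr0n R).
Qed.

Definition weight n w := expR (- \sum_(k < n) lam k (subword k w)).

(** The weight factorises over blocks: the free symbols contribute [K ^ q], the admissible words the
    bound of [sum_inv_multiplicity]. *)
Lemma sum_weight n : \sum_(w <- block_words n) weight n w <=
  \prod_(k < n) ((K ^ q)%:R * (2 * B * (m k)%:R + 1)).
Proof.
have B0 := B_ge0.
elim: n => [|n IH].
  by rewrite /= big_seq1 /weight !big_ord0 oppr0 expR0.
rewrite /= big_allpairs_dep big_ord_recr /=.
have W0 w : 0 <= weight n w by apply: expR_ge0.
have Z0 : 0 <= (K ^ q)%:R * (2 * B * (m n)%:R + 1) :> R.
  by rewrite mulr_ge0// addr_ge0// !mulr_ge0.
apply: le_trans (ler_wpM2r Z0 IH).
rewrite mulr_suml !big_seq; apply: ler_sum => w wn.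
rewrite big_allpairs_dep mulrCA.
apply: (@le_trans _ _
  (\sum_(z <- words K q) weight n w * (2 * B * (m n)%:R + 1))); last first.
  by rewrite big_const_seq count_predT iter_addr_0 size_words -[_ *+ _]mulr_natl.
rewrite [leLHS]big_seq [leRHS]big_seq; apply: ler_sum => z; rewrite mem_words => /eqP zq.
apply: le_trans (ler_wpM2l (W0 w) (sum_inv_multiplicity n)).
rewrite mulr_sumr !big_seq; apply: ler_sum => v; rewrite mem_admissible_words.
move=> /asboolP[y _ yv]; have vn : size v = n.+1 by rewrite -yv size_word.
have wc := size_block_words wn.
rewrite /weight big_ord_recr /= opprD expRD.
have -> : subword n (w ++ z ++ v) = v.
  by rewrite /subword catA drop_size_cat ?size_cat ?wc ?zq// -vn take_size.
rewrite (eq_bigr (fun k : 'I_n => lam k (subword k w))) // => k _; congr (lam _ _).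
have : (c k.+1 <= c n)%N by rewrite (stair_mono (@ltn_bstart q)).
rewrite bstartS /blen -wc => kc; rewrite /subword drop_cat.
rewrite addnA in kc; rewrite ifT.
  by rewrite takel_cat// size_drop leq_subRL// (leq_trans _ kc)// leq_addr.
by rewrite (leq_trans _ kc)// addnS ltnS leq_addr.
Qed.

(** Each factor is at most [D] times the block length, that is [D / e] times [e * m k], and both of
    these are bounded by their exponentials. *)
Lemma prod_weight_bound e : 0 < e -> exists2 C, 0 <= C & forall n,
  \prod_(k < n) ((K ^ q)%:R * (2 * B * (m k)%:R + 1)) <=
    expR (C * n%:R + e * (c n)%:R).
Proof.
move=> e0; have B0 := B_ge0; pose D := (K ^ q)%:R * (2 * B + 1).
have D0 : 0 <= D by rewrite mulr_ge0// addr_ge0// mulr_ge0.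
exists (D / e) => [|n]; first by rewrite divr_ge0// ltW.
have -> : D / e * n%:R + e * (c n)%:R = \sum_(k < n) (D / e + e * (m k)%:R).
  by rewrite big_split /= sumr_const card_ord mulr_natr -mulr_sumr -natr_sum.
rewrite expR_sum; apply: ler_prod => k _; apply/andP; split.
  by rewrite mulr_ge0// addr_ge0// !mulr_ge0.
have m1 : 1 <= (m k)%:R :> R by rewrite -[1]/(1%:R) ler_nat /blen addnS.
apply: (@le_trans _ _ (D / e * (e * (m k)%:R))).
  rewrite mulrA divfK ?gt_eqF// /D -[leRHS]mulrA ler_wpM2l//; lra.
have De0 : 0 <= D / e by apply: divr_ge0 => //; apply: ltW.
have em0 : 0 <= e * (m k)%:R by apply: mulr_ge0 => //; apply: ltW.
rewrite expRD; apply: ler_pM => //.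
  by apply: le_trans (expR_ge1Dx _); rewrite lerDr.
by apply: le_trans (expR_ge1Dx _); rewrite lerDr.
Qed.

Lemma sum_finite_set (U : choiceType) (F : set U) (f : U -> R) : finite_set F ->
  (\sum_(x \in F) (f x)%:E = (\sum_(x <- finmap.enum_fset (fset_set F)) f x)%:E)%E.
Proof. by move=> Ffin; rewrite fsbig_finite//= sumEFin. Qed.

(** Prefixes with too small a product of multiplicities cover the level set. At such a word of [n]
    blocks the cost is at most [expR (- (t - s) * c n)] times its weight, and the total weight is
    subexponential. *)
Lemma level_premeasure_le b s t : s < t ->
  (forall x, level b x -> forall N, exists2 n, (N <= n)%N &
     \sum_(k < n) lam k (word k x) < s * (c n)%:R) ->
  forall r, (cylinder_premeasure t r (level b) <= 1%:E)%E.
Proof.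
move=> st H r; have e0 : 0 < (t - s) / 2 by lra.
have [C C0 HC] := prod_weight_bound e0.
(* Past [N1] half of the gap [t - s] exceeds the cost of [(C + 1) * n + 1], so the words of [n]
   blocks contribute at most [2^-1 ^+ n.+1]. *)
have [N1 HN1] := vanishingD (vanishingZ (C + 1) (@vanishing_natr R q))
  (vanishing_cst q 1) e0.
pose N := maxn N1 r.+1.
pose W := [set w | exists n, [/\ (N <= n)%N, w \in block_words n &
  \sum_(k < n) lam k (subword k w) < s * (c n)%:R]].
apply: (@le_trans _ _ (\esum_(w in W) (expR (- t * (size w)%:R))%:E)%E).
  apply: ereal_inf_lbound; exists W => //; split=> [w [n [Nn wn _]]|x xb].
    rewrite (size_block_words wn) (leq_trans _ (leq_bstart q n))//.
    by apply: leq_trans Nn; apply: leq_maxr.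
  have [n Nn xn] := H x xb N; have xA : sft A x by case: xb.
  exists (mkseq x (c n)); last by rewrite /cylinder /= size_mkseq.
  exists n; split=> //; first exact: mem_block_words.
  by under eq_bigr do rewrite subword_mkseq//.
apply: ge_ereal_sup => _ [F [Ffin FW] <-].
rewrite (sum_finite_set (fun w => expR (- t * (size w)%:R)))// lee_fin.
(* A word of [n] blocks has length [c n >= n], so [M] bounds every level occurring in [F]. *)
pose M := (\max_(w <- finmap.enum_fset (fset_set F)) size w).+1.
pose h n w := if (N <= n)%N then expR (- (t - s) * (c n)%:R) * weight n w else 0.
have h0 n w : 0 <= h n w by rewrite /h; case: ifP => // _; rewrite mulr_ge0// expR_ge0.
apply: (@le_trans _ _ (\sum_(n < M) \sum_(w <- block_words n) h n w)).
  apply: ler_sum_cover => // w wF.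
  have /FW[n [Nn wn sn]] : F w by move: wF; rewrite in_fset_set// inE.
  have wc := size_block_words wn.
  exists n; split=> //.
    by rewrite ltnS (leq_trans (leq_bstart q n))// -wc leq_bigmax_seq.
  by rewrite /h Nn /weight -expRD ler_expR wc; lra.
apply: le_trans (sum_half_pow R M); apply: ler_sum => n _.
rewrite /h; case: (leqP N n) => [Nn|_]; last by rewrite big1 ?exprn_ge0 ?invr_ge0.
rewrite -mulr_sumr; apply: (le_trans (ler_wpM2l (expR_ge0 _) (sum_weight n))).
apply: (le_trans (ler_wpM2l (expR_ge0 _) (HC n))); rewrite -expRD.
have -> : 2^-1 ^+ n.+1 = expR (- (n.+1%:R * ln 2)) :> R.
  by rewrite expRN mulrC expRM_natr lnK ?posrE// exprVn.
rewrite ler_expR.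
have ln2 : ln 2 <= 1 :> R.
  rewrite -ler_expR lnK ?posrE//; have := expR_ge1Dx (1 : R); lra.
have := HN1 n (leq_trans (leq_maxl _ _) Nn); rewrite ler_norml => /andP[_].
have : n.+1%:R * ln 2 <= n.+1%:R :> R by rewrite ler_piMr.
rewrite -natr1; nra.
Qed.

End EntropyUpperBound.

Lemma htop_good b s : level b !=set0 -> (s%:E < htop R (level b))%E -> good b s.
Proof.
(* Multiplicities are at least 1, so every point of the level set witnesses a negative rate. *)
move=> b0 sb; have [s0|s0] := ltP s 0.
  have [x xb] := b0; apply: (level_good xb); exists 0%N => n _.
  apply: (@le_trans _ _ 0); first by rewrite mulr_le0_ge0// ltW.
  by apply: sumr_ge0 => k _; apply/lam_ge0/word_admissible; case: xb.
have [t st tb] : exists2 t, s < t & (t%:E < htop R (level b))%E.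
  case: (htop R (level b)) sb => [y|_|//]; last by exists (s + 1); rewrite ?ltry//; lra.
  by rewrite lte_fin => sy; exists ((s + y) / 2); rewrite ?lte_fin; lra.
apply: contrapT => nb; move: tb; apply/negP; rewrite -leNgt.
apply: (@htop_le _ _ _ _ 1) => //; first lra.
apply: (@level_premeasure_le _ s) => // x xb N.
apply: contrapT => nx; apply: nb; apply: (level_good xb); exists N => n Nn.
by rewrite leNgt; apply/negP => lt; apply: nx; exists n.
Qed.

Lemma good_le b s : good b s -> s <= ln K%:R.
Proof.
move=> [u [uA _ [N HN]]]; have := HN N.+1 (leqnSn N).
have : \sum_(k < N.+1) lam k (word k (u k)) <= \sum_(k < N.+1) ln K%:R * (m k)%:R.
  by apply: ler_sum => k _; apply/lam_le/word_admissible.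
rewrite -mulr_sumr -natr_sum -/(c N.+1) => /[swap] /le_trans H /H.
by rewrite ler_pM2r// ltr0n (leq_trans _ (leq_bstart q N.+1)).
Qed.

Lemma htop_le_lnK b : level b !=set0 -> (htop R (level b) <= (ln K%:R)%:E)%E.
Proof.
move=> b0; rewrite leNgt; apply/negP => lt.
have [t st tb] : exists2 t : R, ln K%:R < t & (t%:E < htop R (level b))%E.
  case: (htop R (level b)) lt => [y|_|//]; last first.
    by exists (ln K%:R + 1); rewrite ?ltry//; lra.
  by rewrite lte_fin => sy; exists ((ln K%:R + y) / 2); rewrite ?lte_fin; lra.
by have := good_le (htop_good b0 tb); rewrite leNgt st.
Qed.

Lemma level_bound b : level b !=set0 -> `|b| <= B.
Proof.
move=> [x [xA xb]]; apply/ler_addgt0Pr => e /xb[N /(_ N.+1 (leqnSn N)) HN].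
have SB : `|\sum_(i < N.+1) d i x| <= B * N.+1%:R.
  apply: (le_trans (ler_norm_sum _ _ _)); rewrite mulr_natr -[X in _ *+ X]card_ord.
  rewrite -sumr_const.
  by apply: ler_sum => i _; apply: d_bound.
rewrite -(@ler_pM2r _ N.+1%:R)// mulrDl; set S := \sum_(_ < _) _ in HN SB.
have -> : `|b| * N.+1%:R = `|S - (S - b * N.+1%:R)|.
  by rewrite subKr normrM (@ger0_norm _ N.+1%:R).
by apply: (le_trans (ler_normB _ _)); rewrite lerD.
Qed.

(** * Concavity and closedness of the entropy *)

Definition entropy_fun b := fine (htop R (level b)).

Lemma htopE b : level b !=set0 -> htop R (level b) = (entropy_fun b)%:E.
Proof.
move=> b0; rewrite fineK// fin_numElt; apply/andP; split.
  by apply: lt_le_trans (htop_ge0 R b0); rewrite ltNyr.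
by apply: le_lt_trans (htop_le_lnK b0) _; rewrite ltry.
Qed.

Lemma entropy_fun_itv b : level b !=set0 -> 0 <= entropy_fun b <= ln K%:R.
Proof. by move=> b0; rewrite -!lee_fin -htopE// htop_ge0 ?htop_le_lnK. Qed.

Lemma entropy_fun_good b s : level b !=set0 -> s < entropy_fun b -> good b s.
Proof. by move=> b0 sb; apply: htop_good; rewrite ?htopE ?lte_fin. Qed.

(** Asking for goodness only at smaller rates absorbs the losses in [good_conv] and [good_limit]. *)
Lemma good_entropy_fun b s :
  (forall e, 0 < e -> good b (s - e)) -> level b !=set0 /\ s <= entropy_fun b.
Proof.
move=> H; have b0 := good_level (H 1 ltr01); split=> //.
apply/ler_addgt0Pr => e e0; rewrite -lerBlDr -lee_fin -htopE//.
exact/good_htop/H.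
Qed.

Lemma entropy_fun_concave a b t : 0 <= t <= 1 ->
  level a !=set0 -> level b !=set0 ->
  level (t * a + (1 - t) * b) !=set0 /\
  t * entropy_fun a + (1 - t) * entropy_fun b <= entropy_fun (t * a + (1 - t) * b).
Proof.
move=> t01 a0 b0; apply: good_entropy_fun => e e0; have e20 : 0 < e / 2 by lra.
have Ga : good a (entropy_fun a - e / 2) by apply: entropy_fun_good => //; lra.
have Gb : good b (entropy_fun b - e / 2) by apply: entropy_fun_good => //; lra.
have := good_conv t01 e20 Ga Gb; congr good; lra.
Qed.

Lemma entropy_fun_limit b s :
  (forall e, 0 < e ->
    exists a, [/\ `|a - b| <= e, level a !=set0 & s <= entropy_fun a]) ->
  level b !=set0 /\ s <= entropy_fun b.
Proof.
move=> H; apply: good_entropy_fun => e e0.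
apply: (@good_limit _ (s - e / 2)) => [|r /H[a [ab a0 sa]]]; first lra.
by exists a => //; apply: entropy_fun_good => //; lra.
Qed.

End Model.

(** * The spectrum *)

Section ConcaveFunctions.
Variables (R : realType) (D : set R) (f : R -> R) (B C : R).
Hypothesis D_bound : forall x, D x -> `|x| <= B.
Hypothesis f_bound : forall x, D x -> 0 <= f x <= C.
Hypothesis f_concave : forall x y t, 0 <= t <= 1 -> D x -> D y ->
  D (t * x + (1 - t) * y) /\
  t * f x + (1 - t) * f y <= f (t * x + (1 - t) * y).
Hypothesis hypograph_closed : forall x s,
  (forall e, 0 < e -> exists y, [/\ `|y - x| <= e, D y & s <= f y]) ->
  D x /\ s <= f x.

(** As [f] is nonnegative, closedness at height 0 puts the infimum and supremum in [D]; convexity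
    fills in the rest. *)
Lemma closed_hypograph_itv : D !=set0 -> exists a b, D = `[a, b]%classic.
Proof.
move=> D0; exists (inf D), (sup D).
have infD : has_inf D.
  by split=> //; exists (- B) => x /D_bound; rewrite ler_norml => /andP[].
have supD : has_sup D.
  by split=> //; exists B => x /D_bound; rewrite ler_norml => /andP[].
have Da : D (inf D).
  have [|//] := @hypograph_closed (inf D) 0 => e /inf_adherent/(_ infD)[x Dx xe].
  exists x; split=> //; last by have /andP[] := f_bound Dx.
  by have := ge_inf infD.2 Dx; rewrite ler_norml; lra.
have Db : D (sup D).
  have [|//] := @hypograph_closed (sup D) 0 => e /sup_adherent/(_ supD)[x Dx xe].
  exists x; split=> //; last by have /andP[] := f_bound Dx.
  by have := ub_le_sup supD.2 Dx; rewrite ler_norml; lra.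
apply/seteqP; split=> x /=; rewrite in_itv /=.
  by move=> Dx; rewrite ge_inf ?ub_le_sup//; [case: supD | case: infD].
move=> /andP[ax xb]; have [ab|ba] := ltP (inf D) (sup D); last first.
  by have -> : x = inf D by lra.
pose t := (sup D - x) / (sup D - inf D).
have t01 : 0 <= t <= 1.
  by rewrite /t divr_ge0 ?ler_pdivrMr /=; lra.
have -> : x = t * inf D + (1 - t) * sup D.
  by rewrite /t; field; lra.
by have [] := f_concave t01 Da Db.
Qed.

(** By concavity and [0 <= f <= C], moving a fraction [t] towards [z] lowers [f] by at most
    [t * C]. *)
Lemma concave_lsc_side x z e : D x -> D z -> 0 < e -> exists2 r, 0 < r &
  forall t, 0 <= t <= 1 -> `|t * (z - x)| < r -> f x - e < f (t * z + (1 - t) * x).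
Proof.
move=> Dx Dz e0; have [zx|zx] := eqVneq z x.
  exists 1 => // t _ _; have -> : t * z + (1 - t) * x = x by rewrite zx; ring.
  lra.
have /andP[fx0 fxC] := f_bound Dx; have /andP[fz0 fzC] := f_bound Dz.
have zx0 : 0 < `|z - x| by rewrite normr_gt0 subr_eq0.
exists (e / (C + 1) * `|z - x|); first by rewrite mulr_gt0// divr_gt0//; lra.
move=> t t01; have /andP[t0 t1] := t01.
rewrite normrM ltr_pM2r// ger0_norm// ltr_pdivlMr; last lra.
have [_] := f_concave t01 Dz Dx; nra.
Qed.

(** Every point of [D] lies between [x] and an endpoint of [D], so the two segments from [x] to the
    endpoints suffice. *)
Lemma concave_lsc x e : D x -> 0 < e -> exists2 r, 0 < r &
  forall y, D y -> `|x - y| < r -> f x - e < f y.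
Proof.
move=> Dx e0; have [a [b Dab]] : exists a b, D = `[a, b]%classic.
  by apply: closed_hypograph_itv; exists x.
have Da : a <= x <= b by move: Dx; rewrite Dab /= in_itv.
have [D1 D2] : D a /\ D b by rewrite Dab /= !in_itv /= lexx; lra.
have [r1 r10 H1] := concave_lsc_side Dx D1 e0.
have [r2 r20 H2] := concave_lsc_side Dx D2 e0.
exists (Num.min r1 r2); first by rewrite lt_min r10.
move=> y Dy; rewrite lt_min => /andP[xr1 xr2].
have /andP[ay yb] : a <= y <= b by move: Dy; rewrite Dab /= in_itv.
have [xy|yx|->] := ltgtP x y; last lra.
- pose t := (y - x) / (b - x); have bx : 0 < b - x by lra.
  have E : t * (b - x) = y - x by rewrite /t divfK// gt_eqF.
  have -> : y = t * b + (1 - t) * x by lra.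
  apply: H2; first by apply/andP; rewrite /t ler_pdivrMr// divr_ge0 ?(ltW bx)//; lra.
  by rewrite E distrC.
- pose t := (x - y) / (x - a).
  have xa : 0 < x - a by lra.
  have E : t * (a - x) = y - x.
    by rewrite -opprB mulrN /t divfK ?opprB// gt_eqF.
  have -> : y = t * a + (1 - t) * x by lra.
  apply: H1; first by apply/andP; rewrite /t ler_pdivrMr// divr_ge0 ?(ltW xa)//; lra.
  by rewrite E distrC.
Qed.

(** Otherwise points of height at least [f x + e] accumulate at [x], and closedness gives
    [f x + e <= f x]. *)
Lemma concave_usc x e : D x -> 0 < e -> exists2 r, 0 < r &
  forall y, D y -> `|x - y| < r -> f y < f x + e.
Proof.
move=> Dx e0; apply: contrapT => H.
have [|_] := @hypograph_closed x (f x + e); last lra.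
move=> r r0; apply: contrapT => nH; apply: H; exists r => // y Dy xy.
rewrite ltNge; apply/negP => le; apply: nH; exists y; split=> //.
by rewrite distrC ltW.
Qed.

Lemma concave_within_continuous : {within D, continuous f}.
Proof.
apply/subspace_continuousP => x Dx; apply/cvgrPdist_lt => e e0.
have [r1 r10 H1] := concave_lsc Dx e0; have [r2 r20 H2] := concave_usc Dx e0.
apply/nbhs_ballP; exists (Num.min r1 r2); first by rewrite /= lt_min r10.
move=> y; rewrite /ball /= lt_min => /andP[xr1 xr2] Dy.
change (`|f x - f y| < e); rewrite ltr_distl.
by have := H1 y Dy xr1; have := H2 y Dy xr2; lra.
Qed.

End ConcaveFunctions.

(** * Connecting words in the subshift *)

Section SubshiftOfFiniteType.
Variables (K : nat) (A : 'M[nat]_K).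

Lemma iter_shiftE i (x : fullshift K) k : iter i (@Defs.shift K) x k = x (i + k)%N.
Proof. by elim: i k => [|i IH] k //=; rewrite /Defs.shift IH addnS. Qed.

Lemma iter_shift_sft i (x : fullshift K) : sft A x -> sft A (iter i (@Defs.shift K) x).
Proof. by move=> xA k; rewrite !iter_shiftE addnS; apply: xA. Qed.

Lemma mx_power_path n (i j : 'I_K) : zero_one_mx A -> (0 < (A ^+ n) i j)%N ->
  exists p : nat -> 'I_K, [/\ p 0%N = i, p n = j &
    forall k, (k < n)%N -> A (p k) (p k.+1) = 1%N].
Proof.
move=> A01; elim: n i => [|n IH] i.
  rewrite expr0 /= mxE; case: eqVneq => [ij _|]; last by [].
  by exists (fun=> i); split.
rewrite exprS mxE => ij.
have [k /andP[ik kj]] : exists k, (0 < A i k)%N && (0 < (A ^+ n) k j)%N.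
  apply: contrapT => H; move: ij; rewrite big1// => k _.
  apply/eqP; rewrite -leqn0 leqNgt; apply/negP => lt; apply: H; exists k.
  by rewrite -muln_gt0.
have [p [p0 pn pA]] := IH k kj.
exists (fun l => if l is l'.+1 then p l' else i); split=> // -[_|l ln].
  by rewrite p0; apply/eqP; rewrite eqn_leq A01 ik.
exact: pA.
Qed.

Lemma exists_connect : zero_one_mx A -> aperiodic_irreducible A ->
  exists q (connect : 'I_K -> 'I_K -> nat -> 'I_K),
  [/\ forall a b, connect a b 0%N = a, forall a b, connect a b q.+1 = b &
      forall a b i, (i <= q)%N -> A (connect a b i) (connect a b i.+1) = 1%N].
Proof.
(* The exponent counts transitions, one more than the number of connecting symbols. *)
move=> A01 [[|q] [// _ Aq]]; exists q.
have : forall ab : 'I_K * 'I_K, exists p : nat -> 'I_K,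
    [/\ p 0%N = ab.1, p q.+1 = ab.2 &
        forall k, (k < q.+1)%N -> A (p k) (p k.+1) = 1%N].
  by move=> [a b]; apply: mx_power_path.
move=> /choice[g Hg]; exists (fun a b => g (a, b)).
by split=> a b; have [] := Hg (a, b).
Qed.

End SubshiftOfFiniteType.

(** * Reduction to bounded potentials *)

Section Potentials.
Variables (R : realType) (K : nat) (A : 'M[nat]_K) (phi : nat -> fullshift K -> R).
Hypothesis phi_equi : uniformly_equicontinuous A phi.

Definition rho l := fine (rho1 A phi l).

Lemma rho_var i l x y : sft A x -> sft A y ->
  (forall j, (i <= j < i + l)%N -> x j = y j) ->
  `|phi i (iter i (@Defs.shift K) x) - phi i (iter i (@Defs.shift K) y)| <= rho l.
Proof.
move=> xA yA xy; rewrite -lee_fin fineK; last by case: phi_equi.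
apply: (@le_trans _ _ (Defs.variation A (phi i) l)); last first.
  by apply: ereal_sup_ubound; exists i.
apply: ereal_sup_ubound; exists (mkseq (iter i (@Defs.shift K) x) l).
exists (iter i (@Defs.shift K) x), (iter i (@Defs.shift K) y).
split=> //; rewrite ?size_mkseq//; split; rewrite /cylinder /= ?size_mkseq//;
  try exact: iter_shift_sft.
by apply/eq_in_map => k; rewrite mem_iota !iter_shiftE => /= kl; rewrite xy//; lia.
Qed.

Lemma rho_cvg0 e : 0 < e -> exists N, forall l, (N <= l)%N -> rho l <= e.
Proof.
move=> e0; have [_ /fine_cvgP[_ /cvgrPdist_le/(_ e e0)]] := phi_equi.
move=> [N _ HN]; exists N => l /HN /=; rewrite sub0r normrN.
exact/le_trans/ler_norm.
Qed.

Lemma birkhoff_averageP (alpha : R) x :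
  birkhoff_average phi x @ \oo --> alpha <->
  forall e, 0 < e -> exists N, forall n, (N <= n)%N ->
    `|\sum_(i < n) phi i (iter i (@Defs.shift K) x) - alpha * n%:R| <= e * n%:R.
Proof.
have E n : (0 < n)%N -> `|alpha - birkhoff_average phi x n| * n%:R =
    `|\sum_(i < n) phi i (iter i (@Defs.shift K) x) - alpha * n%:R|.
  move=> n0; rewrite -[X in _ * X]normr_nat -normrM distrC mulrBl.
  by rewrite /birkhoff_average mulrAC mulVf ?mul1r// pnatr_eq0 -lt0n.
split=> [/cvgrPdist_le H e /H[N _ HN]|H].
  (* The successor excludes [n = 0], where clearing the denominator fails. *)
  exists N.+1 => n Nn; rewrite -E; last by apply: leq_trans Nn.
  by rewrite ler_wpM2r//; apply: HN; apply: ltnW.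
apply/cvgrPdist_le => e /H[N HN]; exists N.+1 => // n /= Nn.
have n0 : (0 < n)%N by apply: leq_trans Nn.
by rewrite -(@ler_pM2r _ n%:R) ?ltr0n// E// HN// ltnW.
Qed.

Variables (x0 : fullshift K) (alpha0 : R).
Hypothesis x0L : level_set A phi alpha0 x0.

(* Subtracting the values along [x0] makes the potentials bounded; adding
   [alpha0] leaves the level sets unchanged. *)
Definition relative_potential i x : R :=
  phi i (iter i (@Defs.shift K) x) - phi i (iter i (@Defs.shift K) x0) + alpha0.

Lemma relative_potential_bound i x : sft A x ->
  `|relative_potential i x| <= rho 0 + `|alpha0|.
Proof.
move=> xA; apply: (le_trans (ler_normD _ _)); rewrite lerD2r.
by apply: rho_var => //; [case: x0L | move=> j; lia].
Qed.

Lemma relative_potential_var i l x y : sft A x -> sft A y ->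
  (forall j, (i <= j < i + l)%N -> x j = y j) ->
  `|relative_potential i x - relative_potential i y| <= rho l.
Proof.
move=> xA yA xy; have -> : relative_potential i x - relative_potential i y =
    phi i (iter i (@Defs.shift K) x) - phi i (iter i (@Defs.shift K) y).
  by rewrite /relative_potential; ring.
exact: rho_var.
Qed.

Lemma level_relative_potential : level A relative_potential = level_set A phi.
Proof.
have [_ /birkhoff_averageP H0] := x0L.
have E n x alpha :
    \sum_(i < n) relative_potential i x - alpha * n%:R =
    (\sum_(i < n) phi i (iter i (@Defs.shift K) x) - alpha * n%:R) -
    (\sum_(i < n) phi i (iter i (@Defs.shift K) x0) - alpha0 * n%:R).
  by rewrite !big_split /= sumrN sumr_const card_ord -[alpha0 *+ n]mulr_natr; ring.
apply/funext => alpha; apply/seteqP; split=> x [xA H]; split=> //.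
- apply/birkhoff_averageP => e e0; have e20 : 0 < e / 2 by lra.
  have [N1 H1] := H _ e20; have [N2 H2] := H0 _ e20.
  exists (maxn N1 N2) => n; rewrite geq_max => /andP[/H1 + /H2]; rewrite E.
  set a := \sum_(_ < _) _ - _; set b := \sum_(_ < _) _ - _ => ab bn.
  have -> : a = (a - b) + b by ring.
  by apply: (le_trans (ler_normD _ _)); lra.
- move=> e e0; have e20 : 0 < e / 2 by lra.
  move/birkhoff_averageP: H => H.
  have [N1 H1] := H _ e20; have [N2 H2] := H0 _ e20.
  exists (maxn N1 N2) => n; rewrite geq_max => /andP[/H1 ? /H2 ?]; rewrite E.
  by apply: (le_trans (ler_normB _ _)); lra.
Qed.

End Potentials.

Theorem theorem2p2 (R : realType) (K : nat) (A : 'M[nat]_K)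
    (phi : nat -> fullshift K -> R) :
  (0 < K)%N ->
  zero_one_mx A ->
  all_symbols_occur A ->
  aperiodic_irreducible A ->
  (forall i, {within sft A, continuous (phi i)}) ->
  uniformly_equicontinuous A phi ->
  let D := [set alpha : R | level_set A phi alpha !=set0] in
  let h := fun alpha : R => htop R (level_set A phi alpha) in
  [/\ {within D, continuous h},
      concave_on D h
    & exists a b : R, D = `[a, b]%classic].
Proof.
move=> _ A01 _ Airr _ phi_equi D h.
have [D0|/set0P[alpha0 [x0 x0L]]] := eqVneq D set0.
  (* The empty domain is the interval with endpoints 1 and 0 in the wrong order. *)
  split; last by exists 1, 0; rewrite D0 set_itv_ge// bnd_simp -ltNge.
    by rewrite D0; apply/subspace_continuousP => x [].
  by move=> a b t; rewrite D0.
have [q [connect [c0 cq cA]]] := exists_connect A01 Airr.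
have x0A : sft A x0 by case: x0L.
have db := relative_potential_bound phi_equi x0L.
have dv := relative_potential_var phi_equi x0 alpha0.
have r0 := rho_cvg0 phi_equi.
have LE := level_relative_potential x0L.
pose f := entropy_fun A (relative_potential phi x0 alpha0).
have DE a : D a <-> level A (relative_potential phi x0 alpha0) a !=set0.
  by rewrite LE.
have hE a : D a -> h a = (f a)%:E.
  by move=> /DE Da; rewrite /h -LE; apply: (htopE q x0A db dv r0 Da).
have concave_f := entropy_fun_concave c0 cq cA x0A db dv r0.
have f_conc a b t : 0 <= t <= 1 -> D a -> D b ->
    D (t * a + (1 - t) * b) /\ t * f a + (1 - t) * f b <= f (t * a + (1 - t) * b).
  by move=> t01 /DE Da /DE Db; rewrite DE; apply: concave_f.
have f_closed a s : (forall e, 0 < e -> exists y, [/\ `|y - a| <= e, D y & s <= f y]) ->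
    D a /\ s <= f a.
  move=> H; rewrite DE; apply: (entropy_fun_limit c0 cq cA x0A db dv r0).
  by move=> e /H[y [ya /DE Dy sy]]; exists y.
have D_bound a : D a -> `|a| <= rho A phi 0 + `|alpha0|.
  by move=> /DE; apply: (level_bound db).
have f_bound a : D a -> 0 <= f a <= ln K%:R.
  by move=> /DE; apply: (entropy_fun_itv q x0A db dv r0).
split.
- apply: (@subspace_eq_continuous _ D _ (EFin \o f)).
    by move=> a; rewrite inE => /hE.
  apply: within_continuous_comp => [y _|].
    by apply: cvg_EFin; [exact: nearW | exact: cvg_id].
  exact: concave_within_continuous D_bound f_bound f_conc f_closed.
- move=> a b t Da Db t01; have [Dab fab] := f_conc a b t t01 Da Db.
  by rewrite !hE// -!EFinM -EFinD lee_fin.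
- by apply: closed_hypograph_itv D_bound f_bound f_conc f_closed _; exists alpha0, x0.
Qed.
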